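(* Let $r_2>r_1>0$, $\lambda_1,\lambda_2,\lambda_3\in\mathbb N_0$, $d\in\mathbb N_0$, $\varrho=(d+1)\nu$, $g(r)=(r-r_1)(r-r_2)$, and let $\boldsymbol\ell_d(\tau)$ consist of the Legendre polynomials of the context. The system of the context with supply rate function $\mathsf s$ is dissipative for all $r\in[r_1,r_2]$, and the origin of the system with $\boldsymbol w(t)\equiv\mathbf 0_q$ is globally uniformly asymptotically stable for all $r\in[r_1,r_2]$, if there exist matrix polynomials $P(\cdot)\in\mathbb S^{n+\varrho}[\mathbb R]_{\lambda_1}$, $S(\cdot)\in\mathbb S^\nu[\mathbb R]_{\lambda_2}$, $U(\cdot)\in\mathbb S^\nu[\mathbb R]_{\lambda_3}$, $\widehat P(\cdot)\in\mathbb S^{n+\varrho}[\mathbb R]$, $\widehat S(\cdot),\widehat U(\cdot)\in\mathbb S^\nu[\mathbb R]$, a symmetric matrix polynomial $\boldsymbol\Psi(\cdot)$, and $\delta_i\in\mathbb N_0$, $i=1,\dots,8$, with $\delta_7\ne0$, such that $$P(\cdot)+\big[\mathsf O_n\oplus(\mathsf D_d\otimes S(\cdot))\big]+g(\cdot)\widehat P(\cdot)\in\boldsymbol\Sigma_{\delta_1}(\mathbb R;\mathbb S^{n+\varrho}_{\succ0}),\qquad\widehat P(\cdot)\in\boldsymbol\Sigma_{\delta_2}(\mathbb R;\mathbb S^{n+\varrho}_{\succeq0}),$$ $$S(\cdot)+g(\cdot)\widehat S(\cdot)\in\boldsymbol\Sigma_{\delta_3}(\mathbb R;\mathbb S^\nu_{\succeq0}),\qquad\widehat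 S(\cdot)\in\boldsymbol\Sigma_{\delta_4}(\mathbb R;\mathbb S^\nu_{\succeq0}),$$ $$U(\cdot)+g(\cdot)\widehat U(\cdot)\in\boldsymbol\Sigma_{\delta_5}(\mathbb R;\mathbb S^\nu_{\succeq0}),\qquad\widehat U(\cdot)\in\boldsymbol\Sigma_{\delta_6}(\mathbb R;\mathbb S^\nu_{\succeq0}),$$ $$-\begin{bmatrix}J_1&\widetilde J\Sigma(\cdot)\\ *&\boldsymbol\Phi_d(\cdot)\end{bmatrix}+g(\cdot)\boldsymbol\Psi(\cdot)\in\boldsymbol\Sigma_{\delta_7}(\mathbb R;\mathbb S^{m+q+n+\nu+\varrho}_{\succ0}),\qquad\boldsymbol\Psi(\cdot)\in\boldsymbol\Sigma_{\delta_8}(\mathbb R;\mathbb S^{m+q+n+\nu+\varrho}_{\succeq0}),$$ where $\mathsf D_d=\bigoplus_{i=0}^d(2i+1)$, $\Gamma=[\mathsf O_{\nu,q}\ A_4\ A_5\ \mathsf O_{\nu,\varrho}]$, $\Sigma(r)=[D_2\ C_1\ C_2\ rC_3(r)]$ and $$\begin{aligned}\boldsymbol\Phi_d(r)=\ &\mathsf{Sy}\left(\begin{bmatrix}\mathsf O_{q,n}&\mathsf O_{q,\varrho}\\ I_n&\mathsf O_{n,\varrho}\\ \mathsf O_{\nu,n}&\mathsf O_{\nu,\varrho}\\ \mathsf O_{\varrho,n}&rI_\varrho\end{bmatrix}P(r)\begin{bmatrix}D_1&A_1&A_2&rA_3(r)\\ \mathsf O_{\varrho,q}&L_d(0)A_4&L_d(0)A_5-L_d(-r)&-\widehat{\mathsf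 L}_d\end{bmatrix}\right)\\ &+\Gamma^\top(rS(r)+rU(r))\Gamma-\big[J_3\oplus\mathsf O_n\oplus rS(r)\oplus(r\mathsf D_d\otimes U(r))\big]-\mathsf{Sy}\left(\begin{bmatrix}\Sigma^\top(r)J_2&\mathsf O_{(n+\nu+\varrho+q),(n+\nu+\varrho)}\end{bmatrix}\right),\end{aligned}$$ with $\widehat{\mathsf L}_d=\acute{\mathsf L}_d\otimes I_\nu$.
   Context: Notation: $\mathsf{Sy}(X)=X+X^\top$; $\oplus$ block-diagonal sum; $\otimes$ Kronecker product; $\mathsf O_{n,m}$ zero matrix, $\mathsf O_n=\mathsf O_{n,n}$; $*$ blocks determined by symmetry; $\mathbb S^n$ real symmetric matrices. Polynomials: $\mathbb S^m[\mathbb R]$ is the set of univariate polynomials with coefficients in $\mathbb S^m$, $\mathbb S^m[\mathbb R]_\lambda$ those of degree $\lambda$. $\boldsymbol\Sigma(\mathbb R;\mathbb S^m_{\succeq0})$ is the set of sum-of-squares $F\in\mathbb S^m[\mathbb R]$, i.e. $F(x)=\Phi(x)^\top\Phi(x)$ for some real $k\times m$ matrix polynomial $\Phi$, $k\in\mathbb N$; $\boldsymbol\Sigma_\delta(\mathbb R;\mathbb S^m_{\succeq0})$ those of degree $2\delta$; $\boldsymbol\Sigma_\delta(\mathbb R;\mathbb S^m_{\succ0})$ those elements which take positive definite values. Legendre polynomials: $\ell_k(r,\tau)=\sum_{j=0}^k\binom kj\binom{k+j}j(\tau/r)^j$, $\boldsymbol\ell_d(\tau)=(\ell_0(r,\tau),\dots,\ell_d(r,\tau))^\top$,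 $L_d(\tau)=\boldsymbol\ell_d(\tau)\otimes I_\nu$; $\acute{\mathsf L}_d\in\mathbb R^{(d+1)\times(d+1)}$ is the unique matrix with $\frac{d}{d\tau}\boldsymbol\ell_d(\tau)=r^{-1}\acute{\mathsf L}_d\boldsymbol\ell_d(\tau)$. System, $t\ge t_0$: $\dot{\boldsymbol x}(t)=A_1\boldsymbol x(t)+A_2\boldsymbol y(t-r)+\int_{-r}^0A_3(r)L_d(\tau)\boldsymbol y(t+\tau)d\tau+D_1\boldsymbol w(t)$, $\boldsymbol y(t)=A_4\boldsymbol x(t)+A_5\boldsymbol y(t-r)$, $\boldsymbol z(t)=C_1\boldsymbol x(t)+C_2\boldsymbol y(t-r)+\int_{-r}^0C_3(r)L_d(\tau)\boldsymbol y(t+\tau)d\tau+D_2\boldsymbol w(t)$, $\boldsymbol x(t_0)=\boldsymbol\xi\in\mathbb R^n$, $\boldsymbol y(t_0+\theta)=\boldsymbol\phi(\theta)$ on $[-r,0)$ with $\boldsymbol\phi\in\widehat{\mathcal C}([-r,0);\mathbb R^\nu)$ (bounded right piecewise continuous functions, sup norm); $\boldsymbol w\in\mathcal L^2([t_0,\infty);\mathbb R^q)$, $\boldsymbol z(t)\in\mathbb R^m$; $rA_3(r)$ and $rC_3(r)$ are polynomial matrices in $r$ ($A_3(r)\in\mathbb R^{n\times\varrho}$, $C_3(r)\in\mathbb R^{m\times\varrho}$); spectral radius $\rho(A_5)<1$; $r$ is an unknown constant in $[r_1,r_2]$. Supply rate: $\mathsf s(\boldsymbol z,\boldsymbol w)=\begin{bmatrix}\boldsymbol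 z\\ \boldsymbol w\end{bmatrix}^\top\begin{bmatrix}\widetilde J^\top J_1^{-1}\widetilde J&J_2\\ *&J_3\end{bmatrix}\begin{bmatrix}\boldsymbol z\\ \boldsymbol w\end{bmatrix}$, $J_1\in\mathbb S^m$, $J_1^{-1}\prec0$, $\widetilde J\in\mathbb R^{m\times m}$, $J_2\in\mathbb R^{m\times q}$, $J_3\in\mathbb S^q$. Dissipative for all $r\in[r_1,r_2]$: there is a differentiable functional $\mathsf v:\mathbb R_+\times\mathbb R^n\times\widehat{\mathcal C}([-r,0);\mathbb R^\nu)\to\mathbb R$ with $\frac d{dt}\mathsf v(r,\boldsymbol x(t),\mathbf y_t(\cdot))-\mathsf s(\boldsymbol z(t),\boldsymbol w(t))\le0$ for all $r\in[r_1,r_2]$, $t\ge t_0$, $\mathbf y_t(\theta)=\boldsymbol y(t+\theta)$, $\theta\in[-r,0)$.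
   Formalization: Since w is only in L², the equation for x and the dissipation inequality are required for almost every t ≥ t0 rather than every t, with t ↦ v(r, x(t), y_t) shown locally absolutely continuous. *)

(* Defs.v *)
From HB Require Import structures.
From mathcomp Require Import all_boot all_order all_algebra.
From mathcomp Require Import complex mxtens.
From mathcomp Require Import all_classical all_reals all_analysis.

Set Implicit Arguments.
Unset Strict Implicit.
Unset Printing Implicit Defensive.

Import Order.TTheory GRing.Theory Num.Theory.
Import numFieldNormedType.Exports.

Local Open Scope classical_set_scope.
Local Open Scope ring_scope.

Section Matrices.
Variable R : realType.

Definition posdefmx m (A : 'M[R]_m) : Prop :=
  A^T = A /\ forall u : 'cV[R]_m, u != 0 -> 0 < (u^T *m A *m u) 0 0.

Definition negdefmx m (A : 'M[R]_m) : Prop := posdefmx (- A).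

Definition Sy m (X : 'M[R]_m) : 'M[R]_m := X + X^T.

(* The infinite supremum is harmless: the spectrum is finite, and [sup set0 = 0]
   covers the matrix of size 0. *)
Definition spectral_radius m (A : 'M[R]_m) : R :=
  sup [set Normc.normc a | a in
        [set a : complex R | eigenvalue (map_mx (real_complex R) A) a]].

End Matrices.

Definition dsum (K : nmodType) m p (A : 'M[K]_m) (B : 'M[K]_p) :
  'M[K]_(m + p) := block_mx A 0 0 B.

Section MatrixPolynomials.
Variable R : realType.

Definition mxeval m p (F : 'M[{poly R}]_(m, p)) (x : R) : 'M[R]_(m, p) :=
  map_mx (horner_eval x) F.

(* The zero matrix polynomial has degree 0. *)
Definition mxdeg m p (F : 'M[{poly R}]_(m, p)) : nat :=
  (\max_(i < m) \max_(j < p) size (F i j)).-1.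

Definition sympoly m (F : 'M[{poly R}]_m) : Prop := F^T = F.

Definition sos_psd (delta : nat) m (F : 'M[{poly R}]_m) : Prop :=
  [/\ sympoly F,
      mxdeg F = (2 * delta)%N
    & exists k (Phi : 'M[{poly R}]_(k, m)),
        forall x, mxeval F x = (mxeval Phi x)^T *m mxeval Phi x].

Definition sos_pd (delta : nat) m (F : 'M[{poly R}]_m) : Prop :=
  sos_psd delta F /\ forall x, posdefmx (mxeval F x).

End MatrixPolynomials.

Section Legendre.
Variable R : realType.

Definition legendre (r : R) (k : nat) (tau : R) : R :=
  \sum_(j < k.+1) ('C(k, j) * 'C(k + j, j))%:R * (tau / r) ^+ j.

Definition ellvec (d : nat) (r tau : R) : 'cV[R]_d.+1 :=
  \col_(k < d.+1) legendre r k tau.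

Definition Lmx (d nu : nat) (r tau : R) : 'M[R]_(d.+1 * nu, nu) :=
  castmx (erefl, mul1n nu) (ellvec d r tau *t (1%:M : 'M[R]_nu)).

Definition is_legendre_derivative_mx (d : nat) (Lac : 'M[R]_d.+1) : Prop :=
  forall r tau : R, 0 < r ->
    is_derive tau 1 (ellvec d r) (r^-1 *: (Lac *m ellvec d r tau)).

Definition Lhat (d nu : nat) (Lac : 'M[R]_d.+1) : 'M[R]_(d.+1 * nu) :=
  Lac *t (1%:M : 'M[R]_nu).

Definition Dmx (d : nat) : 'M[R]_d.+1 :=
  diag_mx (\row_(i < d.+1) (2 * i + 1)%:R).

End Legendre.

Section FunctionSpaces.
Variable R : realType.

(* The bounded right piecewise continuous functions on [-r, 0[, each encoded
   as its extension by 0 to the whole line. *)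
Definition Chat (nu : nat) (r : R) (phi : R -> 'cV[R]_nu) : Prop :=
  [/\ forall theta, theta \notin `[- r, 0[ -> phi theta = 0,
      exists M : R, forall theta, `|phi theta| <= M,
      forall theta, theta \in `[- r, 0[ -> phi @ theta^'+ --> phi theta
    & exists2 E : set R, finite_set E &
        forall theta, theta \in `]- r, 0[ -> ~ E theta ->
          {for theta, continuous phi}].

Definition supnorm (nu : nat) (r : R) (phi : R -> 'cV[R]_nu) : R :=
  sup [set `|phi theta| | theta in `[- r, 0[].

Definition segment (nu : nat) (r : R) (y : R -> 'cV[R]_nu) (t : R) :
  R -> 'cV[R]_nu :=
  patch (fun=> 0) `[- r, 0[ (fun theta => y (t + theta)).

(* `|_| is the max norm on column vectors; stability and differentiability do
   not depend on the choice of norm. *)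
Definition state_norm (n nu : nat) (r : R)
  (x : 'cV[R]_n) (phi : R -> 'cV[R]_nu) : R := Num.max `|x| (supnorm r phi).

(* Frechet differentiability on R^n * Chat([-r, 0[; R^nu). *)
Definition differentiable_functional (n nu : nat) (r : R)
    (v : 'cV[R]_n -> (R -> 'cV[R]_nu) -> R) : Prop :=
  forall x phi, Chat r phi ->
  exists Dv : 'cV[R]_n -> (R -> 'cV[R]_nu) -> R,
  [/\ forall (a : R) h psi k chi, Chat r psi -> Chat r chi ->
        Dv (a *: h + k) (a *: psi + chi) = a * Dv h psi + Dv k chi,
      exists M : R, forall h psi, Chat r psi ->
        `|Dv h psi| <= M * state_norm r h psi
    & forall e : R, 0 < e -> exists2 de : R, 0 < de &
        forall h psi, Chat r psi -> state_norm r h psi < de ->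
          `|v (x + h) (phi + psi) - v x phi - Dv h psi|
            <= e * state_norm r h psi].

Definition abs_continuous (W : normedZmodType R) (a b : R) (f : R -> W) :
    Prop :=
  forall e : R, 0 < e -> exists2 de : R, 0 < de &
    forall s : seq (R * R),
      all (fun p => [&& a <= p.1, p.1 <= p.2 & p.2 <= b]) s ->
      pairwise (fun p q => p.2 <= q.1) s ->
      \sum_(p <- s) (p.2 - p.1) < de ->
      \sum_(p <- s) `|f p.2 - f p.1| < e.

Definition loc_abs_continuous (W : normedZmodType R) (t0 : R) (f : R -> W) :
    Prop := forall b, t0 <= b -> abs_continuous t0 b f.

Definition square_integrable (q : nat) (t0 : R) (w : R -> 'cV[R]_q) : Prop :=
  (forall i, measurable_fun `[t0, +oo[ (fun t => w t i 0)) /\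
  (\int[lebesgue_measure]_(t in `[t0, +oo[)
     (\sum_(i < q) w t i 0 ^+ 2)%:E < +oo)%E.

End FunctionSpaces.

Record delay_system (R : realType) (n nu m q d : nat) := DelaySystem {
  A1 : 'M[R]_n;
  A2 : 'M[R]_(n, nu);
  A3 : R -> 'M[R]_(n, d.+1 * nu);
  A4 : 'M[R]_(nu, n);
  A5 : 'M[R]_nu;
  C1 : 'M[R]_(m, n);
  C2 : 'M[R]_(m, nu);
  C3 : R -> 'M[R]_(m, d.+1 * nu);
  D1 : 'M[R]_(n, q);
  D2 : 'M[R]_(m, q) }.

Section System.
Variables (R : realType) (n nu m q d : nat).
Variable sys : delay_system R n nu m q d.

Definition poly_in_r k (M : R -> 'M[R]_(k, d.+1 * nu)) : Prop :=
  exists F : 'M[{poly R}]_(k, d.+1 * nu),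
    forall r, 0 < r -> r *: M r = mxeval F r.

(* \int_{-r}^0 M L_d(tau) y(t + tau) dtau, entry by entry. *)
Definition distributed_delay k (M : 'M[R]_(k, d.+1 * nu)) (r : R)
    (y : R -> 'cV[R]_nu) (t : R) : 'cV[R]_k :=
  \col_(i < k) \int[lebesgue_measure]_(tau in `[- r, 0])
    ((M *m Lmx d nu r tau *m y (t + tau)) i 0).

Definition xdot_rhs (r : R) (w : R -> 'cV[R]_q)
    (x : R -> 'cV[R]_n) (y : R -> 'cV[R]_nu) (t : R) : 'cV[R]_n :=
  A1 sys *m x t + A2 sys *m y (t - r)
  + distributed_delay (A3 sys r) r y t + D1 sys *m w t.

Definition output (r : R) (w : R -> 'cV[R]_q)
    (x : R -> 'cV[R]_n) (y : R -> 'cV[R]_nu) (t : R) : 'cV[R]_m :=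
  C1 sys *m x t + C2 sys *m y (t - r)
  + distributed_delay (C3 sys r) r y t + D2 sys *m w t.

(* Caratheodory solutions: w is merely square integrable, so the differential
   equation can only be required almost everywhere. *)
Definition is_trajectory (r t0 : R) (xi : 'cV[R]_n) (phi : R -> 'cV[R]_nu)
    (w : R -> 'cV[R]_q) (x : R -> 'cV[R]_n) (y : R -> 'cV[R]_nu) : Prop :=
  [/\ loc_abs_continuous t0 x /\ x t0 = xi,
      forall theta, theta \in `[- r, 0[ -> y (t0 + theta) = phi theta,
      forall t, t0 <= t -> y t = A4 sys *m x t + A5 sys *m y (t - r)
    & {ae @lebesgue_measure R, forall t, t0 <= t ->
        is_derive t 1 x (xdot_rhs r w x y t)}].

Definition supply_rate (J1 Jt : 'M[R]_m) (J2 : 'M[R]_(m, q)) (J3 : 'M[R]_q)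
    (z : 'cV[R]_m) (w : 'cV[R]_q) : R :=
  ((col_mx z w)^T *m block_mx (Jt^T *m invmx J1 *m Jt) J2 J2^T J3
     *m col_mx z w) 0 0.

(* Local absolute continuity of t |-> v(r, x(t), y_t) is what makes the almost
   everywhere derivative meaningful. *)
Definition dissipative (r1 r2 : R) (s : 'cV[R]_m -> 'cV[R]_q -> R) : Prop :=
  exists v : R -> 'cV[R]_n -> (R -> 'cV[R]_nu) -> R,
    (forall r, r1 <= r <= r2 -> differentiable_functional r (v r)) /\
    (forall r t0 xi phi w x y, r1 <= r <= r2 -> Chat r phi ->
       square_integrable t0 w -> is_trajectory r t0 xi phi w x y ->
       let V := fun t : R => v r (x t) (segment r y t) in
       loc_abs_continuous t0 V /\
       {ae @lebesgue_measure R, forall t, t0 <= t ->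
          derivable V t 1 /\ derive1 V t - s (output r w x y t) (w t) <= 0}).

Definition uniformly_stable (r : R) : Prop :=
  forall e : R, 0 < e -> exists2 de : R, 0 < de &
    forall t0 xi phi x y, Chat r phi ->
      is_trajectory r t0 xi phi (fun=> 0) x y -> state_norm r xi phi < de ->
      forall t, t0 <= t -> state_norm r (x t) (segment r y t) < e.

Definition globally_uniformly_attractive (r : R) : Prop :=
  forall b e : R, 0 < b -> 0 < e -> exists2 T : R, 0 <= T &
    forall t0 xi phi x y, Chat r phi ->
      is_trajectory r t0 xi phi (fun=> 0) x y -> state_norm r xi phi < b ->
      forall t, t0 + T <= t -> state_norm r (x t) (segment r y t) < e.

Definition guas (r : R) : Prop :=
  uniformly_stable r /\ globally_uniformly_attractive r.

Definition Gamma_mx : 'M[R]_(nu, q + (n + (nu + d.+1 * nu))) :=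
  row_mx 0 (row_mx (A4 sys) (row_mx (A5 sys) 0)).

Definition Sigma_mx (r : R) : 'M[R]_(m, q + (n + (nu + d.+1 * nu))) :=
  row_mx (D2 sys) (row_mx (C1 sys) (row_mx (C2 sys) (r *: C3 sys r))).

Definition Phi_left (r : R) :
  'M[R]_(q + (n + (nu + d.+1 * nu)), n + d.+1 * nu) :=
  col_mx (row_mx 0 0)
    (col_mx (row_mx 1%:M 0) (col_mx (row_mx 0 0) (row_mx 0 (r%:M)))).

Definition Phi_right (Lac : 'M[R]_d.+1) (r : R) :
  'M[R]_(n + d.+1 * nu, q + (n + (nu + d.+1 * nu))) :=
  col_mx
    (row_mx (D1 sys) (row_mx (A1 sys) (row_mx (A2 sys) (r *: A3 sys r))))
    (row_mx 0 (row_mx (Lmx d nu r 0 *m A4 sys)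
      (row_mx (Lmx d nu r 0 *m A5 sys - Lmx d nu r (- r))
              (- Lhat nu Lac)))).

Definition Phi_mx (Lac : 'M[R]_d.+1) (J2 : 'M[R]_(m, q)) (J3 : 'M[R]_q)
    (P : 'M[{poly R}]_(n + d.+1 * nu)) (S U : 'M[{poly R}]_nu) (r : R) :
  'M[R]_(q + (n + (nu + d.+1 * nu))) :=
  Sy (Phi_left r *m mxeval P r *m Phi_right Lac r)
  + Gamma_mx^T *m (r *: mxeval S r + r *: mxeval U r) *m Gamma_mx
  - dsum J3 (dsum (0 : 'M[R]_n)
      (dsum (r *: mxeval S r) (r *: (Dmx R d *t mxeval U r))))
  - Sy (row_mx ((Sigma_mx r)^T *m J2) 0).

Definition dissipation_block (Lac : 'M[R]_d.+1) (J1 Jt : 'M[R]_m)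
    (J2 : 'M[R]_(m, q)) (J3 : 'M[R]_q)
    (P : 'M[{poly R}]_(n + d.+1 * nu)) (S U : 'M[{poly R}]_nu) (r : R) :
  'M[R]_(m + (q + (n + (nu + d.+1 * nu)))) :=
  block_mx J1 (Jt *m Sigma_mx r) (Jt *m Sigma_mx r)^T
    (Phi_mx Lac J2 J3 P S U r).

End System.

(* Main.v *)
Require Import Defs.
From HB Require Import structures.
From mathcomp Require Import all_boot all_order all_algebra.
From mathcomp Require Import complex mxtens.
From mathcomp Require Import all_classical all_reals all_analysis.
From mathcomp Require Import measurable_realfun.
From mathcomp Require Import zify ring lra.

(** For a delay r in [r1, r2] the multiplier g(r) = (r - r1)(r - r2) is nonpositive, so the
sum-of-squares certificates give, at that r, positive semidefinite S(r) and U(r), a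
positive definite P(r) + (0 (+) D (x) S(r)) and a negative definite block matrix. It
remains to treat one fixed delay, with the Lyapunov-Krasovskii functional

  v(x, phi) = eta^T P eta + int_{-r}^0 phi(tau)^T (r S + (tau + r) U) phi(tau) dtau,

where eta = (x, int L_d phi) collects the state and the Legendre coefficients of the
history.

Along a trajectory the Legendre coefficients satisfy a linear equation, since
derivatives of Legendre polynomials are combinations of Legendre polynomials, and the
derivative of v is a quadratic form in chi = (w, x, y(t - r), r^-1 int L_d y) minus the
integral of y^T U y over the window. The Bessel-Legendre inequality [bessel_legendre]
bounds that integral from below by a quadratic form in the Legendre coefficients; with
the Schur complement [Phi_val_coercive] this gives v' <= s(z, w) - e |chi|^2. The margin
e allows U to be replaced by U + s I with a small s > 0 [strict_dissipation], which adds
the integral of |y|^2 over the window to the decrease. The same inequality applied to P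
and S shows that v is bounded below by a multiple of |x|^2 [lyap_lower].

Since w is only square integrable, the equation holds almost everywhere. The passage
from v' <= 0 almost everywhere to the monotonicity of v is
[abs_continuous_nonincreasing], and v is absolutely continuous with the expected
derivative because x is and because the window integrals are combinations of powers of
t and of primitives of functions that are continuous off a countable set [acd_moment,
acd_lyap].

For w = 0 the functional satisfies v' <= - c v, hence v(t) (1 + c (t - t0)) <= v(t0)
[lyap_decay]. This bounds x uniformly and makes it tend to 0 uniformly. For y, the
diagonal block of y(t - r) in the matrix inequality says that A5 is a strict contraction
in the norm of S [difference_contraction], and y = A4 x + A5 y(t - r) inherits the bound
and the decay of x. *)

Set Implicit Arguments.
Unset Strict Implicit.
Unset Printing Implicit Defensive.

Import Order.TTheory GRing.Theory Num.Theory.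
Import numFieldNormedType.Exports.

Local Open Scope ring_scope.

(** * Integrals of locally bounded measurable functions *)

Section Integral.
Variable R : realType.
Implicit Types (f g : R -> R) (a b c t : R).
Local Open Scope classical_set_scope.
Notation mu := (@lebesgue_measure R).

Definition itg a b f : R := \int[mu]_(x in `[a, b]) f x.

(** These functions are integrable on every bounded interval, and unlike the
integrable functions they are closed under products, which the quadratic terms of the
functional require. *)
Definition bmeas f : Prop :=
  measurable_fun setT f /\
  forall c : R, exists M : R, forall s, `|s| <= c -> `|f s| <= M.

Lemma bmeas_cst c : bmeas (fun=> c).
Proof. by split => // k; exists `|c|. Qed.

Lemma bmeas_id : bmeas id.
Proof. by split => // c; exists c. Qed.

Lemma bmeasD f g : bmeas f -> bmeas g -> bmeas (fun s => f s + g s).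
Proof.
move=> [mf bf] [mg bg]; split; first exact: measurable_funD.
move=> c; have [M Mf] := bf c; have [N Ng] := bg c.
exists (M + N) => s sc; apply: le_trans (ler_normD _ _) _.
by apply: lerD; [exact: Mf|exact: Ng].
Qed.

Lemma bmeasM f g : bmeas f -> bmeas g -> bmeas (fun s => f s * g s).
Proof.
move=> [mf bf] [mg bg]; split; first exact: measurable_funM.
move=> c; have [M Mf] := bf c; have [N Ng] := bg c.
exists (M * N) => s sc; rewrite normrM.
by apply: ler_pM => //; [exact: Mf|exact: Ng].
Qed.

Lemma bmeasZ c f : bmeas f -> bmeas (fun s => c * f s).
Proof. by move=> ?; apply: bmeasM => //; exact: bmeas_cst. Qed.

Lemma bmeas_sum (I : Type) (s : seq I) (P : pred I) (F : I -> R -> R) :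
  (forall i, bmeas (F i)) -> bmeas (fun t => \sum_(i <- s | P i) F i t).
Proof.
move=> bF; elim: s => [|i s IH].
  by under eq_fun do rewrite big_nil; exact: bmeas_cst.
under eq_fun do rewrite big_cons.
by case: (P i) => //; exact: bmeasD.
Qed.

Lemma bmeas_exp f k : bmeas f -> bmeas (fun s => f s ^+ k).
Proof.
move=> bf; elim: k => [|k IH]; first exact: bmeas_cst.
by under eq_fun do rewrite exprS; exact: bmeasM.
Qed.

Lemma bmeas_shift c f : bmeas f -> bmeas (fun s => f (c + s)).
Proof.
move=> [mf bf]; split.
  apply: (measurableT_comp mf); exact: measurable_funD.
move=> k; have [M Mf] := bf (`|c| + k); exists M => s sk; apply: Mf.
by apply: le_trans (ler_normD _ _) _; rewrite lerD2l.
Qed.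

Lemma bmeas_horner (p : {poly R}) : bmeas (fun s => p.[s]).
Proof.
under eq_fun do rewrite horner_coef.
apply: bmeas_sum => i; apply: bmeasZ; apply: bmeas_exp; exact: bmeas_id.
Qed.

Lemma bmeas_integrable a b f : bmeas f -> mu.-integrable `[a, b] (EFin \o f).
Proof.
move=> [mf bf]; apply: measurable_bounded_integrable => //.
- by rewrite /= lebesgue_measure_itv/=; case: ifP => _; rewrite ?ltry.
- exact: measurable_funS mf.
have [M Mf] := bf (Num.max `|a| `|b|).
exists M; split; first exact: num_real.
move=> x Mx s /=; rewrite in_itv/= => /andP[as_ sb].
apply: le_trans (ltW Mx); apply: Mf; rewrite ler_norml; apply/andP; split.
  by rewrite lerNl le_max; apply/orP; left; rewrite -normrN (le_trans _ (ler_norm _))// lerN2.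
by rewrite le_max; apply/orP; right; rewrite (le_trans sb)// ler_norm.
Qed.

Lemma itgD a b f g : bmeas f -> bmeas g ->
  itg a b (fun s => f s + g s) = itg a b f + itg a b g.
Proof. by move=> bf bg; rewrite /itg RintegralD//; apply: bmeas_integrable. Qed.

Lemma itgZ a b c f : bmeas f -> itg a b (fun s => c * f s) = c * itg a b f.
Proof. by move=> bf; rewrite /itg RintegralZl//; exact: bmeas_integrable. Qed.

Lemma itgB a b f g : bmeas f -> bmeas g ->
  itg a b (fun s => f s - g s) = itg a b f - itg a b g.
Proof. by move=> bf bg; rewrite /itg RintegralB//; exact: bmeas_integrable. Qed.

Lemma itg_cst a b c : a <= b -> itg a b (fun=> c) = c * (b - a).
Proof.
move=> ab; rewrite /itg Rintegral_cst//= lebesgue_measure_itv/= lte_fin.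
by case: ltgtP ab => // -> _; rewrite subrr.
Qed.

Lemma itg_eq a b f g : (forall s, a <= s <= b -> f s = g s) ->
  itg a b f = itg a b g.
Proof. by move=> fg; apply: eq_Rintegral => s; rewrite inE/= in_itv/=; exact: fg. Qed.

Lemma itg_sum a b (I : Type) (s : seq I) (P : pred I) (F : I -> R -> R) :
  (forall i, bmeas (F i)) -> a <= b ->
  itg a b (fun t => \sum_(i <- s | P i) F i t) = \sum_(i <- s | P i) itg a b (F i).
Proof.
move=> bF ab; elim: s => [|i s IH].
  rewrite big_nil (@itg_eq _ _ _ (fun=> 0)) ?itg_cst ?mul0r// => s _.
  by rewrite big_nil.
rewrite big_cons -IH; case: ifP => Pi.
  by rewrite -itgD//; [apply: itg_eq => t _; rewrite big_cons Pi|exact: bmeas_sum].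
by apply: itg_eq => t _; rewrite big_cons Pi.
Qed.

Lemma itg_le a b f g : bmeas f -> bmeas g ->
  (forall s, a <= s <= b -> f s <= g s) -> itg a b f <= itg a b g.
Proof.
move=> bf bg fg; apply: le_Rintegral; rewrite ?measurable_itv//.
- exact: bmeas_integrable.
- exact: bmeas_integrable.
Qed.

Lemma itg_ge0 a b f : (forall s, a <= s <= b -> 0 <= f s) -> 0 <= itg a b f.
Proof. by move=> f0; apply: Rintegral_ge0 => s /=; rewrite in_itv/=; exact: f0. Qed.

Lemma itg_norm_le a b f M : bmeas f -> a <= b ->
  (forall s, a <= s <= b -> `|f s| <= M) -> `|itg a b f| <= M * (b - a).
Proof.
move=> bf ab fM; rewrite ler_norml -mulNr -!itg_cst//; apply/andP; split;
  apply: itg_le => //; try exact: bmeas_cst;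
  by move=> s /fM; rewrite ler_norml => /andP[].
Qed.

Lemma itg_split a b c f : bmeas f -> a <= b -> b <= c ->
  itg a c f = itg a b f + itg b c f.
Proof.
move=> bf ab bc; apply/eqP; rewrite addrC -subr_eq; apply/eqP.
rewrite /itg Rintegral_itvB ?bnd_simp//; last exact: bmeas_integrable.
rewrite Rintegral_itv_obnd_cbnd//.
apply: (@integrableS _ _ _ mu `[b, c]) => //; last exact: bmeas_integrable.
exact: subset_itv_oc_cc.
Qed.

(** The value at a single point does not affect an integral; the endpoint is the
case met when a history on a half-open interval is integrated. *)
Lemma itg_eq_co a b f g : bmeas f -> bmeas g ->
  (forall s, a <= s < b -> f s = g s) -> itg a b f = itg a b g.
Proof.
move=> bf bg fg; rewrite /itg -!Rintegral_itv_bndo_bndc.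
- by apply: eq_Rintegral => s; rewrite inE/= in_itv/=; exact: fg.
- apply: (@integrableS _ _ _ mu `[a, b]) => //; last exact: bmeas_integrable.
  exact: subset_itv_co_cc.
- apply: (@integrableS _ _ _ mu `[a, b]) => //; last exact: bmeas_integrable.
  exact: subset_itv_co_cc.
Qed.

Let mshift c : measurable_fun [set: measurableTypeR R]
  (fun s : measurableTypeR R => c + s : measurableTypeR R).
Proof. exact: measurable_funD. Qed.

(** Lebesgue measure is determined by its values on the intervals ]a, b], whose lengths
a translation preserves. *)
Lemma lebesgue_measure_shift c (A : set R) : measurable A ->
  mu A = mu ((fun s => c + s) @^-1` A).
Proof.
pose nu : {measure set (measurableTypeR R) -> \bar R} :=
  measure_function_pushforward__canonical__measure_function_Measure mu (@mshift c).
apply: (@lebesgue_measure_unique R nu) => _ [[a b] _ <-].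
rewrite /nu/= /pushforward.
have -> : (fun s => c + s) @^-1` `]a, b] = `]a - c, b - c]%classic.
  by apply/seteqP; split => s /=; rewrite !in_itv/= ltrBlDl lerBrDl.
rewrite !lebesgue_measure_itv/= !lte_fin ltrD2r; case: ifP => // _.
by rewrite -!EFinB; congr EFin; ring.
Qed.

Lemma itg_shift a b c f : bmeas f ->
  itg a b (fun s => f (c + s)) = itg (c + a) (c + b) f.
Proof.
move=> bf; rewrite /itg /Rintegral; congr fine.
pose sh (s : measurableTypeR R) : measurableTypeR R := c + s.
transitivity (\int[pushforward mu sh]_(x in `[(c + a)%R, (c + b)%R]) (f x)%:E)%E; last first.
  apply/esym/eq_measure_integral => [|? A mA _]; first exact: (mshift c).
  exact: (lebesgue_measure_shift c mA).
have E : (fun s => c + s) @^-1` `[c + a, c + b] = `[a, b]%classic.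
  by apply/seteqP; split => s /=; rewrite !in_itv/= !lerD2l.
rewrite (integral_pushforward (mshift c)).
- by rewrite E.
- by apply/measurable_EFinP; case: bf.
- rewrite E; exact: (bmeas_integrable a b (bmeas_shift c bf)).
- exact: measurable_itv.
Qed.

Lemma is_derive_itg c t f : bmeas f -> c < t -> {for t, continuous f} ->
  is_derive t 1 (fun t => itg c t f) (f t).
Proof.
move=> bf ct ctf.
have tu : t < t + 1 by rewrite ltrDl.
have [dF dE] := @continuous_FTC1_closed _ f c t (t + 1) tu
   (bmeas_integrable _ _ bf) ct ctf.
by apply: (DeriveDef dF); rewrite -derive1E dE.
Qed.

Lemma itg_deriv (p : {poly R}) a b : a < b -> itg a b (horner p^`()) = p.[b] - p.[a].
Proof.
move=> ab; rewrite /itg /Rintegral (@continuous_FTC2 _ _ (horner p)) //.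
- apply: continuous_subspaceT => x; exact: continuous_horner.
- split.
  + by move=> x _; exact: derivable_horner.
  + apply: cvg_at_right_filter; exact: continuous_horner.
  + apply: cvg_at_left_filter; exact: continuous_horner.
- by move=> x _; rewrite derivE.
Qed.
End Integral.

(** * Absolutely continuous functions *)

Section AbsolutelyContinuous.
Variable R : realType.
Implicit Types (f g : R -> R) (a b c t : R).
Local Open Scope classical_set_scope.
Notation mu := (@lebesgue_measure R).

Lemma abs_continuous_pair (W : normedZmodType R) a b (f : R -> W) :
  abs_continuous a b f -> forall e : R, 0 < e -> exists2 de : R, 0 < de &
    forall s t, a <= s -> s <= t -> t <= b -> t - s < de -> `|f t - f s| < e.
Proof.
move=> acf e e0; have [de de0 H] := acf e e0; exists de => // s t as_ st tb tsd.
have := H [:: (s, t)]; rewrite /= as_ st tb !big_seq1 /=; exact.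
Qed.

(** Each step of half the modulus for the tolerance 1 changes [f] by less than 1, and
finitely many steps exhaust the interval. *)
Lemma abs_continuous_bounded (W : normedZmodType R) a b (f : R -> W) :
  abs_continuous a b f -> exists M : R, forall t, a <= t <= b -> `|f t| <= M.
Proof.
move=> /abs_continuous_pair /(_ 1 ltr01)[de de0 H].
have step k t : a <= t <= b -> t <= a + k%:R * (de / 2) -> `|f t| <= `|f a| + k%:R.
  elim: k t => [|k IH] t /andP[at_ tb].
    rewrite mul0r !addr0 => ta.
    by have -> : t = a by apply/le_anti; rewrite ta at_.
  rewrite -natr1 mulrDl mul1r addrA => tk.
  pose s := Num.max a (t - de / 2).
  have de20 : 0 < de / 2 by rewrite divr_gt0.
  have st : s <= t by rewrite ge_max at_/=; lra.
  have as_ : a <= s by rewrite le_max lexx.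
  have sk : s <= a + k%:R * (de / 2).
    rewrite ge_max; apply/andP; split; last lra.
    by rewrite lerDl mulr_ge0// ?ler0n// ltW.
  have {}IH := IH s _ sk; rewrite as_ (le_trans st tb)/= in IH.
  have {}IH := IH isT.
  have : `|f t - f s| < 1.
    apply: H => //; have : t - de / 2 <= s by rewrite le_max lexx orbT.
    lra.
  move=> H1; have := ler_normD (f s) (f t - f s); rewrite addrC subrK.
  by rewrite addrA -lerBlDr; lra.
have [k Hk] : exists k : nat, (b - a) / (de / 2) <= k%:R.
  have := archi_boundP (normr_ge0 ((b - a) / (de / 2))).
  by move=> /ltW Hk; exists (Num.bound `|(b - a) / (de / 2)|); apply: le_trans (ler_norm _) Hk.
exists (`|f a| + k%:R) => t /andP[at_ tb]; apply: step; first by rewrite at_.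
rewrite ler_pdivrMr in Hk; last by rewrite divr_gt0.
lra.
Qed.

Lemma abs_continuousD a b f g : abs_continuous a b f -> abs_continuous a b g ->
  abs_continuous a b (fun t => f t + g t).
Proof.
move=> acf acg e e0; have e20 : 0 < e / 2 by rewrite divr_gt0.
have [d1 d10 H1] := acf _ e20; have [d2 d20 H2] := acg _ e20.
exists (Num.min d1 d2); first by rewrite lt_min d10.
move=> s s1 s2; rewrite lt_min => /andP[sd1 sd2].
have {}H1 := H1 s s1 s2 sd1; have {}H2 := H2 s s1 s2 sd2.
apply: (@le_lt_trans _ _ (\sum_(p <- s) `|f p.2 - f p.1| +
                          \sum_(p <- s) `|g p.2 - g p.1|)); last lra.
rewrite -big_split/=; apply: ler_sum => p _.
by apply: le_trans (ler_normD _ _); rewrite opprD addrACA.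
Qed.

Lemma abs_continuousM a b f g : abs_continuous a b f -> abs_continuous a b g ->
  abs_continuous a b (fun t => f t * g t).
Proof.
move=> acf acg e e0.
have [M Mf] := abs_continuous_bounded acf; have [N Ng] := abs_continuous_bounded acg.
pose K := `|M| + `|N| + 1.
have K0 : 0 < K by rewrite /K ltr_wpDl// addr_ge0.
have e20 : 0 < e / (2 * K) by rewrite divr_gt0// mulr_gt0.
have [d1 d10 H1] := acf _ e20; have [d2 d20 H2] := acg _ e20.
exists (Num.min d1 d2); first by rewrite lt_min d10.
move=> s s1 s2; rewrite lt_min => /andP[sd1 sd2].
have {}H1 := H1 s s1 s2 sd1; have {}H2 := H2 s s1 s2 sd2.
apply: (@le_lt_trans _ _ (K * (\sum_(p <- s) `|f p.2 - f p.1| +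
                          \sum_(p <- s) `|g p.2 - g p.1|))); last first.
  rewrite -[e](@divfK _ (2 * K)) ?gt_eqF ?mulr_gt0// mulrA [X in _ < X]mulrC ltr_pM2l//.
  by lra.
rewrite -big_split/= mulr_sumr big_seq [leRHS]big_seq; apply: ler_sum => p ps.
have /andP[ap1 /andP[p12 p2b]] := allP s1 p ps.
have -> : f p.2 * g p.2 - f p.1 * g p.1 = (f p.2 - f p.1) * g p.2 + f p.1 * (g p.2 - g p.1).
  by ring.
apply: le_trans (ler_normD _ _) _; rewrite !normrM [leRHS]mulrDr; apply: lerD.
  rewrite mulrC ler_wpM2r//; apply: le_trans (Ng _ _) _.
    by rewrite p2b (le_trans ap1).
  by apply: le_trans (ler_norm N) _; rewrite /K; have := normr_ge0 M; lra.
rewrite ler_wpM2r//; apply: le_trans (Mf _ _) _.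
  by rewrite ap1 (le_trans p12).
by apply: le_trans (ler_norm M) _; rewrite /K; have := normr_ge0 N; lra.
Qed.

Lemma abs_continuous_lipschitz a b f M :
  (forall s t, a <= s -> s <= t -> t <= b -> `|f t - f s| <= M * (t - s)) ->
  abs_continuous a b f.
Proof.
move=> fM e e0; have M0 : 0 < `|M| + 1 by rewrite ltr_wpDl.
exists (e / (`|M| + 1)); first by rewrite divr_gt0.
move=> s s1 s2; rewrite ltr_pdivlMr// mulrC mulr_sumr; apply: le_lt_trans.
rewrite big_seq [leRHS]big_seq; apply: ler_sum => p ps.
have /andP[ap1 /andP[p12 p2b]] := allP s1 p ps.
apply: le_trans (fM _ _ _ _ _) _ => //.
by rewrite ler_wpM2r ?subr_ge0//; have := ler_norm M; lra.
Qed.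

Lemma abs_continuous_eq (W : normedZmodType R) a b (f g : R -> W) :
  (forall t, a <= t <= b -> f t = g t) -> abs_continuous a b f -> abs_continuous a b g.
Proof.
move=> fg acf e e0; have [de de0 H] := acf e e0; exists de => // s s1 s2 s3.
apply: le_lt_trans (H s s1 s2 s3); rewrite big_seq [leRHS]big_seq; apply: ler_sum => p ps.
have /andP[ap1 /andP[p12 p2b]] := allP s1 p ps.
by rewrite !fg ?ap1 ?(le_trans p12) ?p2b ?(le_trans ap1).
Qed.

Lemma abs_continuous_sub (W : normedZmodType R) (a b a' b' : R) (f : R -> W) :
  a <= a' -> b' <= b -> abs_continuous a b f -> abs_continuous a' b' f.
Proof.
move=> aa bb acf e e0; have [de de0 H] := acf e e0; exists de => // s s1 s2 s3.
apply: H => //; apply: sub_all s1 => p /and3P[p1 p2 p3].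
by rewrite (le_trans aa p1) p2 (le_trans p3 bb).
Qed.

Lemma abs_continuous_coord n a b (x : R -> 'cV[R]_n) i :
  abs_continuous a b x -> abs_continuous a b (fun t => x t i 0).
Proof.
move=> acx e e0; have [de de0 H] := acx e e0; exists de => // s s1 s2 s3.
apply: le_lt_trans (H s s1 s2 s3); apply: ler_sum => p _.
have -> : x p.2 i 0 - x p.1 i 0 = (x p.2 - x p.1) i 0 by rewrite !mxE.
rewrite [leRHS]mx_normrE.
exact: (le_bigmax _ (fun ij => `|(x p.2 - x p.1) ij.1 ij.2|) (i, 0)).
Qed.


Lemma is_derive_approx f c l : is_derive c 1 f l -> forall e : R, 0 < e ->
  exists2 de : R, 0 < de & forall s, `|s - c| < de -> `|f s - f c - l * (s - c)| <= e * `|s - c|.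
Proof.
move=> [df dfl] e e0.
have /cvgr_dist_le /(_ _ e0) : h^-1 *: (f (h *: 1 + c) - f c) @[h --> 0^'] --> l.
  by rewrite -dfl; exact: df.
rewrite /= => /nbhs_ballP [de /= de0 H].
exists de => // s sc; have [->|sNc] := eqVneq s c.
  by rewrite !subrr mulr0 subr0 !normr0 mulr0.
have sc0 : s - c != 0 by rewrite subr_eq0.
have := H (s - c); rewrite /ball/= sub0r normrN => /(_ sc sc0).
rewrite scaler1 subrK -[X in `|l - X|]/((s - c)^-1 * (f s - f c)) => {}H.
have -> : f s - f c - l * (s - c) = - ((l - (s - c)^-1 * (f s - f c)) * (s - c)).
  by field.
by rewrite normrN normrM ler_wpM2r.
Qed.

Section Creeping.
Variables (a b e : R) (f : R -> R) (O : set R).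
Hypotheses (ab : a <= b) (e0 : 0 < e) (oO : open O).

(** The points reachable from [a] by steps along which [f] either grows at slope
at most [e] or moves inside the open set [O]. The steps of the second kind are
recorded in a list whose total length is bounded by the measure of [O], so that
absolute continuity controls their contribution. *)
Definition creep (t : R) : Prop := a <= t <= b /\
  exists s : seq (R * R), [/\
    all (fun p => [&& a <= p.1, p.1 <= p.2 & p.2 <= t]) s,
    pairwise (fun p q => p.2 <= q.1) s,
    ((\sum_(p <- s) (p.2 - p.1))%:E <= mu (O `&` `[a, t[))%E &
    f t <= f a + e * (t - a) + \sum_(p <- s) `|f p.2 - f p.1|].

Lemma creep_start : creep a.
Proof.
split; first by rewrite lexx.
by exists [::]; split; rewrite ?big_nil ?subrr ?mulr0 ?addr0.
Qed.

Lemma creep_slope t u : creep t -> t <= u <= b -> f u - f t <= e * (u - t) -> creep u.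
Proof.
move=> [/andP[at_ tb] [s [s1 s2 s3 s4]]] /andP[tu ub] ftu.
split; first by rewrite ub (le_trans at_).
exists s; split => //.
- apply: sub_all s1 => p /and3P[-> -> /=] pt; exact: le_trans pt tu.
- apply: le_trans s3 _; apply: le_measure; rewrite ?inE.
  + by apply: measurableI => //; exact: open_measurable.
  + by apply: measurableI => //; exact: open_measurable.
  + apply: setIS => z /=; rewrite !in_itv/= => /andP[-> /=] zt; exact: lt_le_trans zt tu.
- by lra.
Qed.

Lemma creep_jump t u : creep t -> t <= u <= b -> `[t, u[ `<=` O -> creep u.
Proof.
move=> [/andP[at_ tb] [s [s1 s2 s3 s4]]] /andP[tu ub] tuO.
split; first by rewrite ub (le_trans at_).
exists (rcons s (t, u)); split => //.
- rewrite all_rcons /= at_ tu lexx /=.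
  apply: sub_all s1 => p /and3P[-> -> /=] pt; exact: le_trans pt tu.
- rewrite pairwise_rcons s2 andbT /=.
  by apply: sub_all s1 => p /and3P[].
- have -> : O `&` `[a, u[ = (O `&` `[a, t[) `|` `[t, u[.
    apply/seteqP; split => z /=; rewrite !in_itv/=.
      move=> [Oz /andP[az zu]]; have [zt|tz] := ltP z t; [left|right].
        by split => //; rewrite az.
      by rewrite zu.
    move=> [[Oz /andP[-> zt]]|/andP[tz zu]]; first by split => //; exact: lt_le_trans zt tu.
    by split; [apply: tuO; rewrite /= in_itv/= tz|rewrite zu (le_trans at_)].
  rewrite measureU//; first last.
  + apply/seteqP; split => z //=; rewrite !in_itv/= => -[[_ /andP[_ zt]]] /andP[tz _].
    by have := le_lt_trans tz zt; rewrite ltxx.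
  + by apply: measurableI => //; exact: open_measurable.
  rewrite big_rcons/= EFinD; apply: leeD => //.
  rewrite /= lebesgue_measure_itv/= lte_fin; case: ifP => [_|/negbT].
    by rewrite EFinB.
  by rewrite -leNgt lee_fin subr_le0.
- rewrite big_rcons/=; have := ler_norm (f u - f t).
  have : 0 <= e * (u - t) by rewrite mulr_ge0 ?subr_ge0// ltW.
  rewrite !mulrBr; move: s4; rewrite mulrBr; set S := \sum_(_ <- _) _; lra.
Qed.

(** Real induction: if every point of [a, b] can be crossed by a step, the end
point [b] is reached, since the supremum of the reachable points is crossed. *)
Lemma creep_end : (forall c, a <= c <= b -> exists2 de : R, 0 < de &
    forall t u, c - de < t -> t <= c -> c <= u -> u < c + de -> t <= b -> u <= b ->
    a <= t -> creep t -> creep u) -> creep b.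
Proof.
move=> H; pose c := sup creep.
have hs : has_sup creep.
  by split; [exists a; exact: creep_start|exists b => t [/andP[]]].
have ac : a <= c by apply: (sup_upper_bound hs); exact: creep_start.
have cb : c <= b by apply: ge_sup; [exact: hs.1|move=> t [/andP[]]].
have [|de de0 Hc] := H c; first by rewrite ac.
have [t St ct] := sup_adherent de0 hs.
have tc : t <= c by exact: (sup_upper_bound hs).
pose u := Num.min b (c + de / 2).
have cu : c <= u by rewrite le_min cb/=; lra.
have Su : creep u.
  apply: (Hc t u) => //.
  - by rewrite gt_min; apply/orP; right; lra.
  - by case: St => /andP[].
  - by rewrite ge_min lexx.
  - by case: St => /andP[].
have uc : u <= c by exact: (sup_upper_bound hs).
have [bu|ub] := leP b (c + de / 2); first by move: Su; rewrite /u min_l.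
by move: uc; rewrite /u min_r ?(ltW ub)//; lra.
Qed.
End Creeping.

(** Cover the null set where the derivative is not controlled by an open set of
measure below the modulus of absolute continuity: the variation of [f] inside it is
small, and outside it [f] grows at most at an arbitrarily small slope. *)
Lemma abs_continuous_nonincreasing a b f : a <= b -> abs_continuous a b f ->
  {ae mu, forall t, a < t -> t < b -> exists2 l, is_derive t 1 f l & l <= 0} ->
  f b <= f a.
Proof.
move=> ab acf [A [mA A0 NA]].
apply/ler_addgt0Pr => e e0.
(* The slope e' is chosen so that e' * (b - a) <= e / 2. *)
have e1 : 0 < e / (2 * (b - a + 1)) by rewrite divr_gt0// mulr_gt0//; lra.
set e' := e / _ in e1.
have [de de0 H] := acf _ (divr_gt0 e0 (ltr0Sn _ 1)).
(* The end points are uncontrolled as well, since no derivative is assumed there. *)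
pose B := A `|` [set a; b].
have mab : measurable [set a; b] by apply: measurableU.
have mB : measurable B by apply: measurableU.
have B0 : mu B = 0%E.
  apply/eqP; rewrite eq_le measure_ge0 andbT.
  apply: le_trans (measureU2 _ _ _) _ => //.
  rewrite [X in (X + _)%E]A0 add0e.
  rewrite [X in (X <= _)%E](_ : _ = 0%E)//.
  by apply: countable_lebesgue_measure0; apply: finite_set_countable.
have [|O [oO BO muO]] := lebesgue_regularity_outer mB _ de0; first by rewrite [X in (X < _)%E]B0.
have {}muO : (mu O < de%:E)%E.
  rewrite -(setDUK BO) setUC; apply: le_lt_trans (measureU2 _ _ _) _ => //.
    by apply: measurableD => //; exact: open_measurable.
  by rewrite [X in (_ + X)%E]B0 adde0.
have [_ [s [s1 s2 s3 s4]]] : creep a b e' f O b.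
  apply: creep_end => // c /andP[ac cb].
  have [Bc|NBc] := pselect (B c).
    have /nbhs_ballP[de' /= de'0 cO] : nbhs c O by apply: open_nbhs_nbhs; split => //; exact: BO.
    exists de' => // t u ct tc cu uc tb ub at_ St.
    apply: creep_jump St _ _ => //; first by rewrite ub (le_trans tc).
    move=> z /=; rewrite in_itv/= => /andP[tz zu]; apply: cO.
    by rewrite /ball/= ltr_norml; apply/andP; split; lra.
  have ac' : a < c.
    rewrite lt_neqAle ac andbT; apply/eqP => acE; apply: NBc; right; left => //.
  have cb' : c < b.
    by rewrite lt_neqAle cb andbT; apply/eqP => cbE; apply: NBc; right; right.
  have [l dl l0] : exists2 l, is_derive c 1 f l & l <= 0.
    apply: contrapT => Nl; apply: NBc; left; apply: NA => /= Hc; apply: Nl; exact: Hc.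
  have [de' de'0 Hd] := is_derive_approx dl e1.
  exists de' => // t u ct tc cu uc tb ub at_ St.
  apply: creep_slope St _ _ => //; first by rewrite ub (le_trans tc).
  have tc' : `|t - c| < de' by rewrite ltr_norml; apply/andP; split; lra.
  have uc' : `|u - c| < de' by rewrite ltr_norml; apply/andP; split; lra.
  have := Hd _ tc'; have := Hd _ uc'.
  rewrite (ger0_norm (_ : 0 <= u - c)) ?subr_ge0// (ler0_norm (_ : t - c <= 0)) ?subr_le0//.
  move=> /(le_trans (ler_norm _)) H1; rewrite -normrN => /(le_trans (ler_norm _)) H2.
  have l1 : l * (u - c) <= 0 by rewrite mulr_le0_ge0 ?subr_ge0.
  have l2 : 0 <= l * (t - c) by rewrite mulr_le0// subr_le0.
  move: H1 H2 l1 l2; rewrite !mulrDr !mulrN; lra.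
have sde : \sum_(p <- s) (p.2 - p.1) < de.
  rewrite -lte_fin; apply: le_lt_trans s3 _; apply: le_lt_trans muO.
  apply: le_measure; rewrite ?inE; last exact: subIsetl.
    by apply: measurableI => //; exact: open_measurable.
  exact: open_measurable.
have := H s s1 s2 sde => Hs.
have e3 : e' * (b - a) <= e / 2.
  rewrite /e' mulrAC ler_pdivrMr ?mulr_gt0//; last by lra.
  have -> : e / 2 * (2 * (b - a + 1)) = e * (b - a) + e by field.
  by lra.
by lra.
Qed.
End AbsolutelyContinuous.

(** * Legendre polynomials *)

Section LegendrePolynomials.
Variable R : realType.
Implicit Types (p q : {poly R}).

Definition rodrigues k : {poly R} := ('X * ('X + 1)) ^+ k.
(** Rodrigues' formula for the Legendre polynomials shifted to [-1, 0]: it makes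
orthogonality a consequence of integration by parts. *)
Definition legp k : {poly R} := (rodrigues k)^`N(k).

Lemma coef_legp k i : (legp k)`_i = ('C(k, i) * 'C(k + i, i))%:R.
Proof.
rewrite /legp /rodrigues coef_nderivn exprMn mulrC coefMXn ltnNge leq_addr/= addKn.
rewrite exprDn coef_sum.
have [ik|ki] := ltnP i k.+1; last first.
  rewrite (bin_small ki) mul0n big1 ?mul0rn// => j _.
  by rewrite expr1n mulr1 coefMn coefXn gtn_eqF ?mul0rn//; move: (ltn_ord j); lia.
rewrite (bigD1 (rev_ord (Ordinal ik)))//= big1 ?addr0; last first.
  move=> j; rewrite -val_eqE/= subSS => ij.
  rewrite expr1n mulr1 coefMn coefXn (_ : (i == _) = false) ?mul0rn//.
  by apply/negbTE; apply: contraNneq ij => ->; rewrite subKn// -ltnS.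
rewrite expr1n mulr1 coefMn coefXn subSS subKn// eqxx bin_sub//.
by rewrite -[in RHS](bin_sub (leq_addl k i)) addnK -!mulrnA mul1n.
Qed.

Lemma size_legp k : (size (legp k) <= k.+1)%N.
Proof.
by apply/leq_sizeP => i ki; rewrite coef_legp bin_small// mul0n.
Qed.

Lemma horner_legp r k tau : (legp k).[tau / r] = legendre r k tau.
Proof.
rewrite (horner_coef_wide _ (size_legp k)) /legendre.
by apply: eq_bigr => j _; rewrite coef_legp.
Qed.

Lemma derivn_XsubC_exp a q k i : (i <= k)%N ->
  ((('X - a%:P) ^+ k * q)^`(i)).[a] = if i == k then q.[a] *+ k`! else 0.
Proof.
elim: k i q => [|k IH] [|i] q.
- by rewrite derivn0 expr0 mul1r fact0 mulr1n.
- by [].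
- by move=> _; rewrite derivn0 hornerM horner_exp !hornerE subrr expr0n mul0r.
rewrite ltnS => ik; rewrite derivSn.
have -> : (('X - a%:P) ^+ k.+1 * q)^`() =
    ('X - a%:P) ^+ k * (q *+ k.+1 + ('X - a%:P) * q^`()).
  rewrite derivM deriv_exp derivXsubC/= mul1r exprS mulrDr mulrnAl -mulrnAr.
  by rewrite mulrA; congr (_ + _ * _); rewrite mulrC.
rewrite IH// eqSS; case: eqP => // _.
by rewrite !hornerE subrr mul0r addr0 hornerMn -mulrnA factS.
Qed.

Lemma rodrigues_boundary k i a : (i < k)%N -> (a == 0) || (a == -1) ->
  ((rodrigues k)^`(i)).[a] = 0.
Proof.
move=> ik; rewrite /rodrigues exprMn => /orP[] /eqP ->.
  have -> : 'X = 'X - (0 : R)%:P by rewrite subr0.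
  by rewrite derivn_XsubC_exp ?(ltnW ik)// ltn_eqF.
rewrite mulrC; have -> : 'X + 1 = 'X - (-1 : R)%:P by rewrite polyCN opprK.
by rewrite derivn_XsubC_exp ?(ltnW ik)// ltn_eqF.
Qed.

Lemma legp_N1 k : (legp k).[-1] ^+ 2 = 1.
Proof.
have E : (legp k).[-1] *+ k`! = (-1) ^+ k *+ k`!.
  rewrite -hornerMn -nderivn_def /rodrigues exprMn mulrC.
  have -> : 'X + 1 = 'X - (-1 : R)%:P by rewrite polyCN opprK.
  by rewrite derivn_XsubC_exp// eqxx horner_exp hornerX.
have -> : (legp k).[-1] = (-1) ^+ k.
  have f0 : (k`!)%:R != 0 :> R by rewrite pnatr_eq0 -lt0n fact_gt0.
  by apply: (mulIf f0); rewrite !mulr_natr.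
by rewrite -exprM mulnC exprM sqrrN expr1n expr1n.
Qed.

Section Orthogonality.
Variable J : {poly R} -> R.
Hypothesis JD : forall p q, J (p + q) = J p + J q.
Hypothesis JZ : forall c p, J (c *: p) = c * J p.
Hypothesis J_deriv : forall p, J p^`() = p.[0] - p.[-1].

Let J0 : J 0 = 0. Proof. by rewrite -(scale0r (0 : {poly R})) JZ mul0r. Qed.

(** The boundary terms vanish because 0 and -1 are roots of order k of the polynomial
that is differentiated fewer than k times. *)
Lemma rodrigues_byparts k q i : (i <= k)%N ->
  J ((rodrigues k)^`(k) * q) = (-1) ^+ i * J ((rodrigues k)^`(k - i) * q^`(i)).
Proof.
elim: i => [|i IH] ik; first by rewrite subn0 expr0 mul1r derivn0.
rewrite IH ?(ltnW ik)// exprS -!mulrA mulrCA; congr (_ * _).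
have ki : (k - i = (k - i.+1).+1)%N by lia.
have := J_deriv ((rodrigues k)^`(k - i.+1) * q^`(i)).
rewrite !hornerM !rodrigues_boundary ?eqxx ?orbT//; try lia.
rewrite !mul0r subrr derivM -!derivnS -ki JD => /eqP.
by rewrite addr_eq0 => /eqP ->; rewrite mulN1r.
Qed.

Lemma legp_orth_lt k q : (size q <= k)%N -> J (legp k * q) = 0.
Proof.
move=> sq; have E : J ((rodrigues k)^`(k) * q) = 0.
  by rewrite (rodrigues_byparts _ (leqnn k)) (derivn_poly0 sq) mulr0 J0 mulr0.
move: E; rewrite nderivn_def mulrnAl -scaler_nat JZ => /eqP.
by rewrite mulf_eq0 pnatr_eq0 gtn_eqF ?fact_gt0//= => /eqP.
Qed.

(** The norm comes from integrating the derivative of u * l_k(u)^2: the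
polynomial u * l_k'(u) is k * l_k(u) plus terms of lower degree. *)
Lemma legp_norm k : (2 * k + 1)%:R * J (legp k * legp k) = 1.
Proof.
have szq : (size ('X * (legp k)^`() - k%:R *: legp k)%R <= k)%N.
  apply/leq_sizeP => j; rewrite leq_eqVlt => /predU1P[<-|kj].
    rewrite coefB coefZ; case: k => [|k]; first by rewrite coefXM eqxx mul0r subr0.
    by rewrite coefXM/= coef_deriv mulr_natl subrr.
  rewrite coefB coefZ (leq_sizeP _ _ (size_legp k) j kj) mulr0 subr0 coefXM.
  case: eqP => // _; rewrite coef_deriv (leq_sizeP _ _ (size_legp k)) ?mul0rn//.
  by rewrite prednK//; apply: leq_trans kj.
have := J_deriv ('X * (legp k * legp k)).
rewrite !hornerM !hornerX mul0r mulN1r sub0r opprK -[_ * _.[-1]]expr2 legp_N1 => E.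
rewrite -[RHS]E; have -> : ('X * (legp k * legp k))^`() = (2 * k + 1)%:R *: (legp k * legp k) +
    2%:R *: (legp k * ('X * (legp k)^`() - k%:R *: legp k)).
  rewrite !derivM derivX mul1r natrD natrM -!mul_polyC.
  by rewrite !(rmorphD, rmorphM, rmorph_nat, rmorph1)/=; ring.
by rewrite JD !JZ (legp_orth_lt szq) mulr0 addr0.
Qed.

Lemma legp_orthonormal i j :
  (2 * i + 1)%:R * J (legp i * legp j) = (i == j)%:R.
Proof.
have [<-|ij] := eqVneq i j; first exact: legp_norm.
have [lij|lji|/eqP] := ltngtP i j; last by rewrite (negbTE ij).
  by rewrite mulrC [_ * legp j]mulrC legp_orth_lt ?mul0r// (leq_trans (size_legp i)).
by rewrite legp_orth_lt ?mulr0// (leq_trans (size_legp j)).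
Qed.
End Orthogonality.

End LegendrePolynomials.

(** * Quadratic forms *)

Section QuadraticForms.
Variable R : realType.

Definition blf m p (A : 'M[R]_(m, p)) (u : 'cV[R]_m) (v : 'cV[R]_p) : R :=
  (u^T *m A *m v) 0 0.
Notation qf A u := (blf A u u).
Definition sqn m (u : 'cV[R]_m) : R := \sum_i u i 0 ^+ 2.

Lemma blfE m p (A : 'M[R]_(m, p)) u v :
  blf A u v = \sum_i \sum_j u i 0 * A i j * v j 0.
Proof.
rewrite /blf mxE exchange_big; apply: eq_bigr => j _.
by rewrite mxE mulr_suml; apply: eq_bigr => i _; rewrite mxE.
Qed.

Lemma blfDl m p (A : 'M[R]_(m, p)) u1 u2 v :
  blf A (u1 + u2) v = blf A u1 v + blf A u2 v.
Proof. by rewrite /blf linearD/= !mulmxDl mxE. Qed.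

Lemma blfDr m p (A : 'M[R]_(m, p)) u v1 v2 :
  blf A u (v1 + v2) = blf A u v1 + blf A u v2.
Proof. by rewrite /blf mulmxDr mxE. Qed.

Lemma blfZl m p (A : 'M[R]_(m, p)) c u v : blf A (c *: u) v = c * blf A u v.
Proof. by rewrite /blf linearZ/= -!scalemxAl mxE. Qed.

Lemma blfZr m p (A : 'M[R]_(m, p)) c u v : blf A u (c *: v) = c * blf A u v.
Proof. by rewrite /blf -!scalemxAr mxE. Qed.

Lemma blfNl m p (A : 'M[R]_(m, p)) u v : blf A (- u) v = - blf A u v.
Proof. by rewrite -scaleN1r blfZl mulN1r. Qed.

Lemma blfNr m p (A : 'M[R]_(m, p)) u v : blf A u (- v) = - blf A u v.
Proof. by rewrite -scaleN1r blfZr mulN1r. Qed.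

Lemma blf0l m p (A : 'M[R]_(m, p)) v : blf A 0 v = 0.
Proof. by rewrite /blf trmx0 !mul0mx mxE. Qed.

Lemma blf0r m p (A : 'M[R]_(m, p)) u : blf A u 0 = 0.
Proof. by rewrite /blf mulmx0 mxE. Qed.

Lemma blfD m p (A B : 'M[R]_(m, p)) u v : blf (A + B) u v = blf A u v + blf B u v.
Proof. by rewrite /blf mulmxDr mulmxDl mxE. Qed.

Lemma blfZ m p c (A : 'M[R]_(m, p)) u v : blf (c *: A) u v = c * blf A u v.
Proof. by rewrite /blf -scalemxAr -scalemxAl mxE. Qed.

Lemma blfN m p (A : 'M[R]_(m, p)) u v : blf (- A) u v = - blf A u v.
Proof. by rewrite -scaleN1r blfZ mulN1r. Qed.

Lemma blf0 m p u v : blf (0 : 'M[R]_(m, p)) u v = 0.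
Proof. by rewrite /blf mulmx0 mul0mx mxE. Qed.

Lemma blf_sumr m p (A : 'M[R]_(m, p)) u (I : finType) (F : I -> 'cV[R]_p) :
  blf A u (\sum_i F i) = \sum_i blf A u (F i).
Proof. by rewrite /blf mulmx_sumr summxE. Qed.

Lemma blf_suml m p (A : 'M[R]_(m, p)) v (I : finType) (F : I -> 'cV[R]_m) :
  blf A (\sum_i F i) v = \sum_i blf A (F i) v.
Proof. by rewrite /blf linear_sum/= !mulmx_suml summxE. Qed.

Lemma blf_mul m p k l (A : 'M[R]_(m, p)) (B : 'M[R]_(m, k)) (C : 'M[R]_(p, l)) u v :
  blf A (B *m u) (C *m v) = blf (B^T *m A *m C) u v.
Proof. by rewrite /blf trmx_mul !mulmxA. Qed.

Lemma blf_tr m p (A : 'M[R]_(m, p)) u v : blf A^T v u = blf A u v.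
Proof. by rewrite /blf -[u^T *m A *m v]trmxK [RHS]mxE !trmx_mul trmxK mulmxA. Qed.

Lemma blf_Sy m (A : 'M[R]_m) u : qf (Sy A) u = 2 * qf A u.
Proof. by rewrite /Sy blfD blf_tr mulr2n mulrDl mul1r. Qed.

Lemma blf_col m1 m2 p1 p2 (A : 'M[R]_(m1, p1)) B C D u1 u2 (v1 : 'cV_p1) (v2 : 'cV_p2) :
  blf (block_mx A B C D) (col_mx u1 u2 : 'cV_(m1 + m2)) (col_mx v1 v2)
  = blf A u1 v1 + blf B u1 v2 + (blf C u2 v1 + blf D u2 v2).
Proof.
rewrite /blf tr_col_mx mul_row_block mul_row_col !mulmxDl !mxE; ring.
Qed.

Lemma qf_dsum m1 m2 (A : 'M[R]_m1) (B : 'M[R]_m2) u v :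
  qf (dsum A B) (col_mx u v) = qf A u + qf B v.
Proof. by rewrite /dsum blf_col !blf0 addr0 add0r. Qed.

Lemma sqnE m (u : 'cV[R]_m) : sqn u = qf 1%:M u.
Proof.
by rewrite /blf mulmx1 mxE; apply: eq_bigr => i _; rewrite mxE expr2.
Qed.

Lemma qf_scalar m c (u : 'cV[R]_m) : qf c%:M u = c * sqn u.
Proof. by rewrite sqnE -blfZ scale_scalar_mx mulr1. Qed.

Lemma sqn_ge0 m (u : 'cV[R]_m) : 0 <= sqn u.
Proof. by apply: sumr_ge0 => i _; rewrite sqr_ge0. Qed.

Lemma sqn_col m1 m2 (u : 'cV[R]_m1) (v : 'cV[R]_m2) : sqn (col_mx u v) = sqn u + sqn v.
Proof.
rewrite /sqn big_split_ord/=; congr (_ + _); apply: eq_bigr => i _.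
  by rewrite col_mxEu.
by rewrite col_mxEd.
Qed.

Lemma coord_le_sqn m (u : 'cV[R]_m) i : u i 0 ^+ 2 <= sqn u.
Proof. by rewrite /sqn (bigD1 i)//= lerDl sumr_ge0// => j _; rewrite sqr_ge0. Qed.

Lemma coord_le_norm m (u : 'cV[R]_m) i : `|u i 0| <= `|u|.
Proof.
rewrite [leRHS]mx_normrE.
exact: (le_bigmax _ (fun ij => `|u ij.1 ij.2|) (i, 0)).
Qed.

Lemma norm_le_coord m (u : 'cV[R]_m) M : 0 <= M ->
  (forall i, `|u i 0| <= M) -> `|u| <= M.
Proof.
move=> M0 uM; rewrite [leLHS]mx_normrE; apply: bigmax_le => // -[i j] _ /=.
by rewrite (ord1 j).
Qed.

Lemma norm_le_sqn m (u : 'cV[R]_m) M : 0 <= M -> sqn u <= M ^+ 2 -> `|u| <= M.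
Proof.
move=> M0 uM; apply: norm_le_coord => // i.
rewrite -(ler_pXn2r (ltn0Sn 1)) ?nnegrE// -normrX ger0_norm ?sqr_ge0//.
exact: le_trans (coord_le_sqn _ _) uM.
Qed.

Lemma sqn_le_norm m (u : 'cV[R]_m) : sqn u <= m%:R * `|u| ^+ 2.
Proof.
rewrite /sqn; apply: (@le_trans _ _ (\sum_(i < m) `|u| ^+ 2)); last first.
  by rewrite sumr_const card_ord mulr_natl.
apply: ler_sum => i _.
by rewrite -real_normK ?num_real// lerXn2r ?nnegrE// coord_le_norm.
Qed.

Definition mxabs m p (A : 'M[R]_(m, p)) : R := \sum_i \sum_j `|A i j|.

Lemma mxabs_ge0 m p (A : 'M[R]_(m, p)) : 0 <= mxabs A.
Proof. by do 2 (apply: sumr_ge0 => ? _). Qed.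

Lemma blf_norm_le m p (A : 'M[R]_(m, p)) u v : `|blf A u v| <= mxabs A * (`|u| * `|v|).
Proof.
rewrite blfE /mxabs mulr_suml; apply: le_trans (ler_norm_sum _ _ _) _.
apply: ler_sum => i _; rewrite mulr_suml; apply: le_trans (ler_norm_sum _ _ _) _.
apply: ler_sum => j _; rewrite !normrM -mulrA mulrCA ler_wpM2l//.
by apply: ler_pM => //; exact: coord_le_norm.
Qed.

Lemma qf_le_sqn m (A : 'M[R]_m) u : qf A u <= mxabs A * sqn u.
Proof.
rewrite blfE /mxabs mulr_suml; apply: ler_sum => i _; rewrite mulr_suml.
apply: ler_sum => j _; apply: le_trans (ler_norm _) _.
rewrite !normrM mulrAC mulrC ler_wpM2l//.
have Hi := coord_le_sqn u i; have Hj := coord_le_sqn u j.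
have := sqr_ge0 (`|u i 0| - `|u j 0|).
rewrite sqrrB !real_normK ?num_real// => H; lra.
Qed.

Lemma norm_mulmx_le k l (A : 'M[R]_(k, l)) (v : 'cV[R]_l) : `|A *m v| <= mxabs A * `|v|.
Proof.
apply: norm_le_coord => [|i]; first by rewrite mulr_ge0// mxabs_ge0.
rewrite mxE; apply: le_trans (ler_norm_sum _ _ _) _.
rewrite /mxabs (bigD1 i)//= mulrDl -[leLHS]addr0; apply: lerD.
  rewrite mulr_suml; apply: ler_sum => j _; rewrite normrM ler_wpM2l//.
  exact: coord_le_norm.
by rewrite mulr_ge0//; apply: sumr_ge0 => a _; apply: sumr_ge0.
Qed.

Definition psd m (A : 'M[R]_m) : Prop := forall u, 0 <= qf A u.

(** Cauchy-Schwarz, from the discriminant of t |-> A(u - t v, u - t v). *)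
Lemma psd_cauchy_schwarz m (A : 'M[R]_m) u v : A^T = A -> psd A ->
  blf A u v ^+ 2 <= qf A u * qf A v.
Proof.
move=> sA pA; have vu : blf A v u = blf A u v by rewrite -[in LHS]sA blf_tr.
have H t : 0 <= qf A u - 2 * t * blf A u v + t ^+ 2 * qf A v.
  have := pA (u - t *: v); rewrite blfDl !blfDr !blfNl !blfNr !blfZl !blfZr vu.
  by congr (_ <= _); ring.
have [v0|v0] := eqVneq (qf A v) 0.
  rewrite v0 mulr0; have [->|b0] := eqVneq (blf A u v) 0; first by rewrite expr0n.
  have := H ((qf A u + 1) / (2 * blf A u v)); rewrite v0 mulr0 addr0.
  have -> : 2 * ((qf A u + 1) / (2 * blf A u v)) * blf A u v = qf A u + 1 by field.
  by have := pA u; lra.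
have v1 : 0 < qf A v by rewrite lt_neqAle eq_sym v0 pA.
have := H (blf A u v / qf A v).
have -> : qf A u - 2 * (blf A u v / qf A v) * blf A u v + (blf A u v / qf A v) ^+ 2 * qf A v
   = (qf A u * qf A v - blf A u v ^+ 2) / qf A v by field.
by rewrite pmulr_lge0 ?invr_gt0// subr_ge0.
Qed.

Lemma psd_scalar m (s : R) : 0 <= s -> psd (s%:M : 'M[R]_m).
Proof. by move=> s0 u; rewrite qf_scalar mulr_ge0// sqn_ge0. Qed.

Lemma psdD m (A B : 'M[R]_m) : psd A -> psd B -> psd (A + B).
Proof. by move=> pA pB u; rewrite blfD addr_ge0. Qed.

Lemma posdef_psd m (A : 'M[R]_m) : posdefmx A -> psd A.
Proof.
move=> [_ pA] u; have [->|u0] := eqVneq u 0; first by rewrite blf0l.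
exact/ltW/pA.
Qed.

(** A positive definite form dominates a multiple of the Euclidean one: each
coordinate u_i is the A-product of u with A^-1 e_i, so Cauchy-Schwarz for A bounds
u_i ^ 2 by a constant times A(u, u). *)
Lemma posdef_coercive m (A : 'M[R]_m) : posdefmx A ->
  exists2 e : R, 0 < e & forall u, e * sqn u <= qf A u.
Proof.
move=> pA; have [sA pA'] := pA; have psA := posdef_psd pA.
have uA : A \in unitmx.
  rewrite -row_free_unit -kermx_eq0; apply/eqP/row_matrixP => i; rewrite row0.
  apply/eqP; apply: contraT => k0.
  have kA : row i (kermx A) *m A = 0 by rewrite -row_mul mulmx_ker row0.
  have := pA' (row i (kermx A))^T; rewrite trmx_eq0 k0 trmxK kA mul0mx mxE ltxx.
  by move=> /(_ isT).
pose e_ i : 'cV[R]_m := invmx A *m delta_mx i 0.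
have coordE (u : 'cV[R]_m) i : u i 0 = blf A (e_ i) u.
  rewrite /blf /e_ trmx_mul trmx_inv sA -!mulmxA mulKmx// trmx_delta.
  by rewrite -rowE !mxE.
pose K := \sum_i qf A (e_ i).
have K0 : 0 <= K by apply: sumr_ge0 => i _; exact: psA.
exists (K + 1)^-1; first by rewrite invr_gt0 ltr_wpDl.
move=> u; rewrite ler_pdivrMl ?ltr_wpDl//.
apply: (@le_trans _ _ (K * qf A u)); last first.
  by rewrite ler_wpM2r ?lerDl//; exact: psA.
rewrite /sqn /K mulr_suml; apply: ler_sum => i _.
by rewrite coordE; exact: psd_cauchy_schwarz.
Qed.

(** The S-procedure: on [r1, r2] the multiplier g is nonpositive, so that a constraint
relaxed by g times a positive semidefinite matrix implies the unrelaxed one. *)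
Lemma psd_multiplier m (A B : 'M[R]_m) c : c <= 0 -> psd (A + c *: B) -> psd B -> psd A.
Proof.
move=> c0 pAB pB u; have := pAB u; rewrite blfD blfZ.
have := mulr_le0_ge0 c0 (pB u); lra.
Qed.

Lemma posdef_multiplier m (A B : 'M[R]_m) c : c <= 0 -> B^T = B -> posdefmx (A + c *: B) ->
  psd B -> posdefmx A.
Proof.
move=> c0 sB [sAB pAB] pB; split.
  by move: sAB; rewrite linearD linearZ/= sB => /addIr.
move=> u u0; have := pAB u u0; rewrite -!/(blf _ _ _) blfD blfZ.
have := mulr_le0_ge0 c0 (pB u); lra.
Qed.
Lemma qf_young m (A : 'M[R]_m) th u v : psd A -> 0 < th ->
  qf A (u + v) <= (1 + th) * qf A u + (1 + th^-1) * qf A v.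
Proof.
move=> pA th0; have := pA (th *: u - v).
rewrite !blfDl !blfDr !blfNl !blfNr !blfZl !blfZr => H.
have {}H : 0 <= th^-1 * (th * (th * qf A u) - th * blf A u v + (- (th * blf A v u) + qf A v)).
  apply: mulr_ge0; first by rewrite invr_ge0 ltW.
  by move: H; congr (_ <= _); ring.
have E : th^-1 * (th * (th * qf A u) - th * blf A u v + (- (th * blf A v u) + qf A v))
   = th * qf A u - blf A u v - blf A v u + th^-1 * qf A v.
  by field; rewrite gt_eqF.
by move: H; rewrite E; lra.
Qed.

Lemma sum_mxtens m p (F : 'I_(m * p) -> R) :
  \sum_k F k = \sum_i \sum_a F (mxtens_index (i, a)).
Proof.
rewrite pair_big/= (reindex (@mxtens_index m p)).
  by apply: eq_bigr => -[i a].
by exists (@mxtens_unindex m p) => k _; rewrite ?mxtens_indexK ?mxtens_unindexK.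
Qed.

(** The i-th block of a vector indexed by a Kronecker product. *)
Definition subcol m p (u : 'cV[R]_(m * p)) (i : 'I_m) : 'cV[R]_p :=
  \col_a u (mxtens_index (i, a)) 0.

Lemma blf_tens m p (A : 'M[R]_m) (B : 'M[R]_p) u v :
  blf (A *t B) u v = \sum_i \sum_j A i j * blf B (subcol u i) (subcol v j).
Proof.
rewrite blfE sum_mxtens; apply: eq_bigr => i _.
transitivity (\sum_a \sum_j \sum_b
    u (mxtens_index (i, a)) 0 * (A i j * B a b) * v (mxtens_index (j, b)) 0).
  apply: eq_bigr => a _; rewrite sum_mxtens; apply: eq_bigr => j _; apply: eq_bigr => b _.
  by rewrite tensmxE.
rewrite exchange_big; apply: eq_bigr => j _; rewrite blfE mulr_sumr; apply: eq_bigr => a _.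
rewrite mulr_sumr; apply: eq_bigr => b _; rewrite !mxE; ring.
Qed.

Lemma qf_Dmx_tens d p (B : 'M[R]_p) (u : 'cV[R]_(d.+1 * p)) :
  qf (Dmx R d *t B) u = \sum_(i < d.+1) (2 * i + 1)%:R * qf B (subcol u i).
Proof.
rewrite blf_tens; apply: eq_bigr => i _; rewrite (bigD1 i)//= big1 ?addr0.
  by rewrite !mxE eqxx mulr1n.
by move=> j ji; rewrite !mxE eq_sym (negbTE ji) mulr0n mul0r.
Qed.

Lemma sqn_subcol m p (u : 'cV[R]_(m * p)) : sqn u = \sum_i sqn (subcol u i).
Proof.
rewrite /sqn sum_mxtens; apply: eq_bigr => i _; apply: eq_bigr => a _; by rewrite mxE.
Qed.

End QuadraticForms.
Notation qf A u := (blf A u u).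

(** * Derivatives of moments of the history *)

Section AbsolutelyContinuousDerivative.
Variables (R : realType) (t0 : R) (G : set R).
Hypothesis G_gt : forall t, G t -> t0 < t.
Implicit Types (f g : R -> R) (a b c t : R).

(** Locally absolutely continuous functions together with their derivative at the
times of [G], in practice almost all times after [t0]. *)
Definition acd f f' : Prop :=
  loc_abs_continuous t0 f /\ forall t, G t -> is_derive t 1 f (f' t).

Lemma acd_eq f g f' g' : (forall t, t0 <= t -> f t = g t) ->
  (forall t, G t -> f' t = g' t) -> acd f f' -> acd g g'.
Proof.
move=> fg fg' [acf df]; split=> [b t0b|t Gt].
  by apply: abs_continuous_eq (acf b t0b) => t /andP[+ _]; exact: fg.
rewrite -fg'//; apply: near_eq_is_derive (df t Gt).
near=> s; apply: fg; apply/ltW.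
by near: s; apply: lt_nbhsr; exact: G_gt.
Unshelve. all: by end_near. Qed.

Lemma acd_cst c : acd (fun=> c) (fun=> 0).
Proof.
split=> [b t0b|t _]; last exact: is_derive_cst.
by apply: (@abs_continuous_lipschitz _ _ _ _ 0) => s t; rewrite subrr normr0 mul0r.
Qed.

Lemma acd_id : acd id (fun=> 1).
Proof.
split=> [b t0b|t _]; last exact: is_derive_id.
apply: (@abs_continuous_lipschitz _ _ _ _ 1) => s t _ st _.
by rewrite ger0_norm ?subr_ge0// mul1r.
Qed.

Lemma acdD f g f' g' : acd f f' -> acd g g' ->
  acd (fun t => f t + g t) (fun t => f' t + g' t).
Proof.
move=> [acf df] [acg dg]; split=> [b t0b|t Gt].
  by apply: abs_continuousD; [exact: acf|exact: acg].
have := df t Gt; have := dg t Gt => H1 H2; exact: is_deriveD.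
Qed.

Lemma acdM f g f' g' : acd f f' -> acd g g' ->
  acd (fun t => f t * g t) (fun t => f' t * g t + f t * g' t).
Proof.
move=> [acf df] [acg dg]; split=> [b t0b|t Gt].
  by apply: abs_continuousM; [exact: acf|exact: acg].
have := df t Gt; have := dg t Gt => H1 H2.
apply: is_derive_eq (is_deriveM H2 H1) _.
by rewrite addrC mulrC -!/(GRing.scale _ _) /GRing.scale/=.
Qed.

Lemma acdZ c f f' : acd f f' -> acd (fun t => c * f t) (fun t => c * f' t).
Proof.
move=> acf; apply: acd_eq (acdM (acd_cst c) acf) => // t _.
by rewrite mul0r add0r.
Qed.

Lemma acdN f f' : acd f f' -> acd (fun t => - f t) (fun t => - f' t).
Proof.
by move=> acf; apply: acd_eq (acdZ (-1) acf) => t _; rewrite mulN1r.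
Qed.

Lemma acdB f g f' g' : acd f f' -> acd g g' ->
  acd (fun t => f t - g t) (fun t => f' t - g' t).
Proof. by move=> acf acg; apply: acdD => //; exact: acdN. Qed.

Lemma acd_sum (I : Type) (s : seq I) (F F' : I -> R -> R) :
  (forall i, acd (F i) (F' i)) ->
  acd (fun t => \sum_(i <- s) F i t) (fun t => \sum_(i <- s) F' i t).
Proof.
move=> aF; elim: s => [|i s IH].
  by apply: acd_eq (acd_cst 0) => t _; rewrite big_nil.
by apply: acd_eq (acdD (aF i) IH) => t _; rewrite big_cons.
Qed.

Lemma acd_horner_opp (p : {poly R}) :
  acd (fun t => p.[- t]) (fun t => - p^`().[- t]).
Proof.
elim/poly_ind: p => [|p c IH].
  by apply: acd_eq (acd_cst 0) => t _; rewrite ?linear0 ?horner0 ?oppr0.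
apply: acd_eq (acdD (acdM IH (acdN acd_id)) (acd_cst c)) => t _.
  by rewrite hornerMXaddC.
by rewrite derivMXaddC !hornerE; ring.
Qed.

Lemma acd_itg c f : bmeas f -> c < t0 ->
  (forall t, G t -> {for t, continuous f}) -> acd (fun t => itg c t f) f.
Proof.
move=> bf ct0 cf; split=> [b t0b|t Gt]; last first.
  by apply: is_derive_itg => //; [exact: lt_trans (G_gt Gt)|exact: cf].
have [M fM] := bf.2 (Num.max `|c| `|b|).
apply: (@abs_continuous_lipschitz _ _ _ _ M) => s t t0s st tb.
have cs : c <= s by exact: le_trans (ltW ct0) t0s.
rewrite (itg_split bf cs st) addrC addKr; apply: itg_norm_le => // u /andP[su ut].
apply: fM; rewrite ler_norml; apply/andP; split.
  rewrite lerNl le_max; apply/orP; left; rewrite -normrN.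
  by apply: le_trans (ler_norm _); rewrite lerN2; exact: le_trans su.
by rewrite le_max; apply/orP; right; apply: le_trans (ler_norm _); exact: le_trans tb.
Qed.

Variable r : R.
Hypothesis r0 : 0 < r.

(** The lower end is moved by the change of variable s - r, so that both terms are
integrals from a fixed point. *)
Lemma acd_window f : bmeas f ->
  (forall t, G t -> {for t, continuous f} /\ {for t - r, continuous f}) ->
  acd (fun t => itg (t - r) t f) (fun t => f t - f (t - r)).
Proof.
move=> bf cf; pose c := t0 - r - 1.
have ct0 : c < t0 by have := r0; rewrite /c; lra.
have cr : c + r < t0 by rewrite /c; lra.
have A1 := acd_itg bf ct0 (fun t Gt => (cf t Gt).1).
have bg : bmeas (fun s => f (- r + s)) by exact: bmeas_shift.
have A2 : acd (fun t => itg (c + r) t (fun s => f (- r + s))) (fun t => f (- r + t)).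
  apply: acd_itg => // t Gt; have [_ cft] := cf t Gt.
  apply: (@continuous_comp _ _ _ (fun s => - r + s) f).
    by apply: cvgD; [exact: cvg_cst|exact: cvg_id].
  by rewrite addrC.
apply: acd_eq (acdB A1 A2) => [t t0t|t _]; last by rewrite addrC [- r + _]addrC addrC.
rewrite itg_shift// (_ : - r + (c + r) = c); last by ring.
rewrite (_ : - r + t = t - r); last by ring.
rewrite (@itg_split _ c (t - r) t)//; first by ring.
  by rewrite /c; lra.
by rewrite lerBlDr lerDl ltW.
Qed.

Definition moment (p : {poly R}) f t : R :=
  itg (- r) 0 (fun tau => p.[tau] * f (t + tau)).

Lemma nderivn_deriv (p : {poly R}) k : p^`N(k)^`() = p^`()^`N(k).
Proof.
have E : p^`N(k)^`() *+ k`! = p^`()^`N(k) *+ k`!.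
  by rewrite -derivMn -!nderivn_def -derivSn -derivnS.
apply/polyP => i; have := congr1 (fun q : {poly R} => q`_i) E; rewrite !coefMn.
by apply: pmulrnI; rewrite fact_gt0.
Qed.

(** Taylor's formula at -t separates the variables in p(s - t), so that a moment of the
sliding history becomes a combination of polynomials in t and of integrals over
[t - r, t] of functions independent of t. No differentiation under the integral sign
is then needed. *)
Lemma moment_taylor (p : {poly R}) f k t : bmeas f -> (size p <= k)%N ->
  moment p f t = \sum_(i < k) p^`N(i).[- t] * itg (t - r) t (fun s => s ^+ i * f s).
Proof.
move=> bf sk; rewrite /moment.
have bX i : bmeas (fun s => s ^+ i * f s).
  by apply: bmeasM => //; apply: bmeas_exp; exact: bmeas_id.
transitivity (itg (- r) 0 (fun tau => p.[(t + tau) - t] * f (t + tau))).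
  by apply: itg_eq => tau _; congr (p.[_] * _); ring.
rewrite (@itg_shift _ _ _ t (fun s => p.[s - t] * f s)); last first.
  apply: bmeasM => //; under eq_fun do rewrite addrC.
  exact: (bmeas_shift (- t) (bmeas_horner p)).
rewrite addr0; under [RHS]eq_bigr do rewrite -itgZ//.
rewrite -itg_sum.
- apply: itg_eq => s _; rewrite addrC (nderiv_taylor_wide _ sk); last exact: mulrC.
  by rewrite mulr_suml; apply: eq_bigr => i _; rewrite mulrA.
- by move=> i; apply: bmeasZ.
- by rewrite lerBlDr lerDl ltW.
Qed.

Lemma acd_moment p f : bmeas f ->
  (forall t, G t -> {for t, continuous f} /\ {for t - r, continuous f}) ->
  acd (moment p f) (fun t => p.[0] * f t - p.[- r] * f (t - r) - moment p^`() f t).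
Proof.
move=> bf cf; pose k := size p.
have cX i t : {for t, continuous f} -> {for t, continuous (fun s : R => s ^+ i * f s : R)}.
  by move=> cft; apply: cvgM => //; exact: exprn_continuous.
have bX i : bmeas (fun s => s ^+ i * f s).
  by apply: bmeasM => //; apply: bmeas_exp; exact: bmeas_id.
have A i := acdM (acd_horner_opp p^`N(i)) (acd_window (bX i)
  (fun t Gt => conj (cX i t (cf t Gt).1) (cX i (t - r) (cf t Gt).2))).
apply: acd_eq (acd_sum (index_enum 'I_k) A) => t Gt.
  by rewrite (moment_taylor _ bf (leqnn (size p))).
have sk : (size p^`() <= k)%N.
  by have [->|p0] := eqVneq p 0; [rewrite linear0 size_poly0|exact/ltnW/lt_size_deriv].
rewrite (moment_taylor _ bf sk) big_split/=.
under eq_bigr do rewrite mulNr nderivn_deriv.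
rewrite sumrN addrC; congr (_ - _).
under eq_bigr do rewrite mulrBr !mulrA.
rewrite sumrB -!mulr_suml; congr (_ * _ - _ * _).
  rewrite -[in RHS](addNr t) (nderiv_taylor_wide _ (leqnn k))//; exact: mulrC.
rewrite [in RHS](_ : - r = - t + (t - r)); last by ring.
rewrite (nderiv_taylor_wide _ (leqnn k))//; exact: mulrC.
Qed.

End AbsolutelyContinuousDerivative.

(** * The Bessel-Legendre inequality *)

Section Bessel.
Variables (R : realType).
Local Open Scope ring_scope.

Definition bmeasv m (phi : R -> 'cV[R]_m) : Prop := forall i, bmeas (fun s => phi s i 0).

Definition vitg a b m (phi : R -> 'cV[R]_m) : 'cV[R]_m :=
  \col_i itg a b (fun s => phi s i 0).

Lemma bmeasvZ m (f : R -> R) (phi : R -> 'cV[R]_m) : bmeas f -> bmeasv phi ->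
  bmeasv (fun s => f s *: phi s).
Proof. by move=> bf bphi i; under eq_fun do rewrite mxE; exact: bmeasM. Qed.

Lemma bmeasvD m (phi psi : R -> 'cV[R]_m) : bmeasv phi -> bmeasv psi ->
  bmeasv (fun s => phi s + psi s).
Proof. by move=> bphi bpsi i; under eq_fun do rewrite mxE; exact: bmeasD. Qed.

Lemma bmeasv_shift m c (phi : R -> 'cV[R]_m) : bmeasv phi -> bmeasv (fun s => phi (c + s)).
Proof. move=> bphi i; exact: (bmeas_shift c (bphi i)). Qed.

Lemma bmeas_blf m p (A : 'M[R]_(m, p)) phi psi : bmeasv phi -> bmeasv psi ->
  bmeas (fun s => blf A (phi s) (psi s)).
Proof.
move=> bphi bpsi; under eq_fun do rewrite blfE.
apply: bmeas_sum => i; apply: bmeas_sum => j; apply: bmeasM => //.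
by apply: bmeasM => //; exact: bmeas_cst.
Qed.

Lemma vitg_mul a b m p (A : 'M[R]_(m, p)) phi : a <= b -> bmeasv phi ->
  vitg a b (fun s => A *m phi s) = A *m vitg a b phi.
Proof.
move=> ab bphi; apply/colP => i; rewrite !mxE.
transitivity (itg a b (fun s => \sum_j A i j * phi s j 0)).
  by apply: itg_eq => s _; rewrite mxE.
rewrite itg_sum//; last by move=> j; apply: bmeasZ.
by apply: eq_bigr => j _; rewrite itgZ// mxE.
Qed.

Lemma vitgD a b m (phi psi : R -> 'cV[R]_m) : bmeasv phi -> bmeasv psi ->
  vitg a b (fun s => phi s + psi s) = vitg a b phi + vitg a b psi.
Proof.
move=> bphi bpsi; apply/colP => i; rewrite !mxE -itgD//.
by apply: itg_eq => s _; rewrite mxE.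
Qed.

Lemma vitgZ a b m c (phi : R -> 'cV[R]_m) : bmeasv phi ->
  vitg a b (fun s => c *: phi s) = c *: vitg a b phi.
Proof.
move=> bphi; apply/colP => i; rewrite !mxE -itgZ//.
by apply: itg_eq => s _; rewrite mxE.
Qed.

Lemma vitg_eq a b m (phi psi : R -> 'cV[R]_m) :
  (forall s, a <= s <= b -> phi s = psi s) -> vitg a b phi = vitg a b psi.
Proof. by move=> E; apply/colP => i; rewrite !mxE; apply: itg_eq => s /E ->. Qed.

Lemma itg_blf_l a b m p (A : 'M[R]_(m, p)) phi v : a <= b -> bmeasv phi ->
  itg a b (fun s => blf A (phi s) v) = blf A (vitg a b phi) v.
Proof.
move=> ab bphi; rewrite -blf_tr /blf -vitg_mul// mxE.
by apply: itg_eq => s _; apply/esym; exact: (blf_tr A).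
Qed.

Lemma itg_blf_r a b m p (A : 'M[R]_(m, p)) phi u : a <= b -> bmeasv phi ->
  itg a b (fun s => blf A u (phi s)) = blf A u (vitg a b phi).
Proof. by move=> ab bphi; rewrite /blf -vitg_mul// mxE. Qed.

Variables (r : R) (r0 : 0 < r).
Let r0' : - r <= 0. Proof. by rewrite oppr_le0 ltW. Qed.

Lemma bmeas_legendre i : bmeas (legendre r i).
Proof.
apply: bmeas_sum => j; apply: bmeasZ; apply: bmeas_exp.
by apply: bmeasM; [exact: bmeas_id|exact: bmeas_cst].
Qed.

(** The rescaled integral q |-> r^-1 * int_{-r}^0 q(tau / r) dtau is linear and integrates
derivatives between -1 and 0, which is all that orthogonality depends on. *)
Lemma legendre_orthogonal i j :
  itg (- r) 0 (fun tau => legendre r i tau * legendre r j tau) =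
  (i == j)%:R * r / (2 * i + 1)%:R.
Proof.
have bp (p : {poly R}) : bmeas (fun tau => p.[tau / r]).
  under eq_fun do rewrite horner_coef.
  apply: bmeas_sum => k; apply: bmeasZ; apply: bmeas_exp.
  by apply: bmeasM; [exact: bmeas_id|exact: bmeas_cst].
pose J (p : {poly R}) := r^-1 * itg (- r) 0 (fun tau => p.[tau / r]).
have JD p q : J (p + q) = J p + J q.
  rewrite /J -mulrDr -itgD//; congr (_ * _); apply: itg_eq => s _; exact: hornerD.
have JZ c p : J (c *: p) = c * J p.
  rewrite /J mulrCA; congr (_ * _); rewrite -itgZ//; apply: itg_eq => s _; exact: hornerZ.
have J_deriv p : J p^`() = p.[0] - p.[-1].
  pose P := r *: (p \Po (r^-1 *: 'X)).
  have PE s : P.[s] = r * p.[s / r].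
    by rewrite /P hornerZ horner_comp hornerZ hornerX mulrC [s / r]mulrC mulrC.
  have -> : J p^`() = r^-1 * itg (- r) 0 (horner P^`()).
    congr (_ * _); apply: itg_eq => s _.
    rewrite /P derivZ deriv_comp derivZ derivX hornerZ hornerM hornerZ hornerC mulr1.
    by rewrite horner_comp hornerZ hornerX mulrCA divff ?gt_eqF// mulr1 mulrC.
  rewrite itg_deriv ?oppr_lt0// !PE mul0r mulNr divff ?gt_eqF// -mulrBr mulKf//.
  by rewrite gt_eqF.
have := legp_orthonormal JD JZ J_deriv i j; rewrite /J => <-.
rewrite (@itg_eq _ _ _ _ (fun tau => (legp R i * legp R j).[tau / r])); last first.
  by move=> s _; rewrite hornerM !horner_legp.
have : (2 * i + 1)%:R != 0 :> R by rewrite pnatr_eq0 addn1.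
    move: (2 * i + 1)%:R => N N0.
    by field; rewrite ?N0 ?(gt_eqF r0).
Qed.

(** Projecting [phi] on the Legendre polynomials can only decrease its quadratic
energy: the energy of the remainder is nonnegative. *)
Lemma bessel_legendre d m (S : 'M[R]_m) phi : psd S -> bmeasv phi ->
  r^-1 * \sum_(i < d.+1) (2 * i + 1)%:R *
     qf S (vitg (- r) 0 (fun tau => legendre r i tau *: phi tau))
  <= itg (- r) 0 (fun tau => qf S (phi tau)).
Proof.
move=> pS bphi; pose l (i : 'I_d.+1) tau : R := legendre r i tau.
pose c (i : 'I_d.+1) := vitg (- r) 0 (fun tau => l i tau *: phi tau).
pose w (i : 'I_d.+1) : R := (2 * i + 1)%:R / r.
pose th tau := \sum_i (w i * l i tau) *: c i.
have bl i : bmeas (l i) by exact: bmeas_legendre.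
have lo i j : itg (- r) 0 (fun tau => l i tau * l j tau) = (i == j)%:R * r / (2 * i + 1)%:R.
  exact: legendre_orthogonal.
have bth : bmeasv th.
  move=> a; rewrite /th; under eq_fun do rewrite summxE.
  apply: bmeas_sum => i; under eq_fun do rewrite mxE.
  by apply: bmeasM; [exact: bmeasZ|exact: bmeas_cst].
have blphi i : bmeasv (fun tau => l i tau *: phi tau) by apply: bmeasvZ.
pose E := \sum_i w i * qf S (c i).
have I1 : itg (- r) 0 (fun tau => blf S (phi tau) (th tau)) = E.
  transitivity (itg (- r) 0 (fun tau => \sum_i w i * blf S (l i tau *: phi tau) (c i))).
    apply: itg_eq => s _; rewrite /th blf_sumr; apply: eq_bigr => i _.
    by rewrite blfZr blfZl mulrA.
  rewrite itg_sum//; last first.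
    by move=> i; apply: bmeasZ; apply: bmeas_blf => // k; exact: bmeas_cst.
  apply: eq_bigr => i _; rewrite itgZ ?itg_blf_l//.
  by apply: bmeas_blf => // k; exact: bmeas_cst.
have I2 : itg (- r) 0 (fun tau => blf S (th tau) (phi tau)) = E.
  transitivity (itg (- r) 0 (fun tau => \sum_i w i * blf S (c i) (l i tau *: phi tau))).
    apply: itg_eq => s _; rewrite /th blf_suml; apply: eq_bigr => i _.
    by rewrite blfZl blfZr mulrA.
  rewrite itg_sum//; last first.
    by move=> i; apply: bmeasZ; apply: bmeas_blf => // k; exact: bmeas_cst.
  apply: eq_bigr => i _; rewrite itgZ ?itg_blf_r//.
  by apply: bmeas_blf => // k; exact: bmeas_cst.
have I3 : itg (- r) 0 (fun tau => qf S (th tau)) = E.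
  transitivity (itg (- r) 0 (fun tau =>
      \sum_i \sum_j (w i * w j * blf S (c i) (c j)) * (l i tau * l j tau))).
    apply: itg_eq => s _; rewrite /th blf_suml; apply: eq_bigr => i _.
    rewrite blf_sumr; apply: eq_bigr => j _.
    by rewrite blfZl blfZr; ring.
  rewrite itg_sum//; last first.
    by move=> i; apply: bmeas_sum => j; apply: bmeasZ; exact: bmeasM.
  apply: eq_bigr => i _; rewrite itg_sum//; last first.
    by move=> j; apply: bmeasZ; exact: bmeasM.
  rewrite (bigD1 i)//= big1 ?addr0 => [|j ji].
    rewrite (itgZ _ _ _ (bmeasM (bl i) (bl i))) lo eqxx mul1r /w.
    have : (2 * i + 1)%:R != 0 :> R by rewrite pnatr_eq0 addn1.
    move: (2 * i + 1)%:R => N N0.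
    by field; rewrite ?N0 ?(gt_eqF r0).
  by rewrite (itgZ _ _ _ (bmeasM (bl i) (bl j))) lo eq_sym (negbTE ji) !mul0r mulr0.
have : 0 <= itg (- r) 0 (fun tau => qf S (phi tau - th tau)).
  by apply: itg_ge0 => s _; exact: pS.
have -> : itg (- r) 0 (fun tau => qf S (phi tau - th tau)) =
   itg (- r) 0 (fun tau => (qf S (phi tau) + qf S (th tau)) -
     (blf S (phi tau) (th tau) + blf S (th tau) (phi tau))).
  apply: itg_eq => s _; rewrite blfDl !blfDr !blfNl !blfNr; ring.
have b1 : bmeas (fun tau => qf S (phi tau)) by exact: bmeas_blf.
have b2 : bmeas (fun tau => qf S (th tau)) by exact: bmeas_blf.
have b3 : bmeas (fun tau => blf S (phi tau) (th tau)) by exact: bmeas_blf.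
have b4 : bmeas (fun tau => blf S (th tau) (phi tau)) by exact: bmeas_blf.
rewrite itgB ?itgD ?I1 ?I2 ?I3; try exact: bmeasD.
- move=> H; have -> : r^-1 * \sum_(i < d.+1) (2 * i + 1)%:R * qf S (c i) = E.
    by rewrite /E mulr_sumr; apply: eq_bigr => i _; rewrite /w mulrA [r^-1 * _]mulrC.
  lra.
- by [].
- by [].
- by [].
- by [].
Qed.

End Bessel.

(** * Histories *)

Section Histories.
Variable R : realType.
Local Open Scope classical_set_scope.
Implicit Types (f : R -> R).

(** The preimage of an open set differs from its interior by discontinuities. *)
Lemma countable_discontinuities_measurable f (E : set R) : countable E ->
  (forall t, ~ E t -> {for t, continuous f}) -> measurable_fun setT f.
Proof.
move=> cE cf; apply: (measurability _ (RGenOpens.measurableE R)) => _ [_ [a [b ->]] <-].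
rewrite setTI; set A := f @^-1` _.
have -> : A = A^° `|` (A `&` E).
  apply/seteqP; split => t; last by case=> [/interior_subset|[]].
  move=> At; have [Et|NEt] := pselect (E t); [by right|left].
  by apply: (cf t NEt); apply: open_nbhs_nbhs; split => //; exact: interval_open.
apply: measurableU.
  by apply: open_measurable; exact: open_interior.
apply: countable_measurable => //; apply: (sub_countable _ cE).
by apply: subset_card_le; exact: subIsetr.
Qed.

Lemma continuous_coord m (T : topologicalType) (phi : T -> 'cV[R]_m) t i :
  {for t, continuous phi} -> {for t, continuous (fun s => phi s i 0)}.
Proof.
move=> cphi; apply: (@continuous_comp _ _ _ phi (fun v : 'cV[R]_m => v i 0)) => //.
exact: coord_continuous.
Qed.

Lemma is_derive_coord m (phi : R -> 'cV[R]_m) (t : R) v i :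
  is_derive t 1 phi v -> is_derive t 1 (fun s => phi s i 0) (v i 0).
Proof.
move=> [dphi Dphi].
have H : h^-1 *: (phi (h *: 1 + t) i 0 - phi t i 0) @[h --> 0^'] --> v i 0.
  have H1 : h^-1 *: (phi (h *: 1 + t) - phi t) @[h --> 0^'] --> v by rewrite -Dphi; exact: dphi.
  have H2 := cvg_comp _ _ H1 (@coord_continuous R m 1 i 0 v).
  by apply: cvg_trans H2; apply: near_eq_cvg; near=> h => /=; rewrite !mxE.
have D : derivable (fun s => phi s i 0) t 1 by apply/cvg_ex; exists (v i 0).
by apply: (DeriveDef D); apply/cvg_lim.
Unshelve. all: by end_near. Qed.

Lemma has_ubound_norm nu r (phi : R -> 'cV[R]_nu) : Chat r phi ->
  has_ubound [set `|phi theta| | theta in `[- r, 0[].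
Proof. by move=> [_ [M phiM] _ _]; exists M => _ [theta _ <-]. Qed.

Lemma supnorm_ge0 nu r (phi : R -> 'cV[R]_nu) : 0 < r -> Chat r phi -> 0 <= supnorm r phi.
Proof.
move=> r0 Cphi; apply: (@le_trans _ _ `|phi (- r)|) => //.
apply: (ub_le_sup (has_ubound_norm Cphi)); exists (- r) => //=.
by rewrite in_itv/= lexx oppr_lt0.
Qed.

Lemma le_supnorm nu r (phi : R -> 'cV[R]_nu) theta : 0 < r -> Chat r phi ->
  `|phi theta| <= supnorm r phi.
Proof.
move=> r0 Cphi; have [it|nit] := boolP (theta \in `[- r, 0[%R).
  by apply: (ub_le_sup (has_ubound_norm Cphi)); exists theta.
by case: (Cphi) => [/(_ _ nit) -> _ _ _]; rewrite normr0 supnorm_ge0.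
Qed.

Lemma supnorm_le nu r (phi : R -> 'cV[R]_nu) M : 0 < r ->
  (forall theta, - r <= theta < 0 -> `|phi theta| <= M) -> supnorm r phi <= M.
Proof.
move=> r0 phiM; apply: ge_sup.
  by exists `|phi (- r)|, (- r) => //=; rewrite in_itv/= lexx oppr_lt0.
by move=> _ [theta /= + <-]; rewrite in_itv/=; exact: phiM.
Qed.

Lemma Chat_continuous nu r (phi : R -> 'cV[R]_nu) : 0 < r -> Chat r phi ->
  exists2 E : set R, finite_set E & [/\ E (- r), E 0 &
    forall theta, ~ E theta -> {for theta, continuous phi}].
Proof.
move=> r0 [phi0 _ _ [E fE cE]].
exists (E `|` [set - r; 0]).
  by rewrite finite_setU; split => //; exact: finite_set2.
split; [by right; left|by right; right|].
move=> t /not_orP[NE /not_orP[/eqP tr /eqP t0]].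
have [it|nit] := boolP (t \in `]- r, 0[%R); first exact: cE.
have out s : (s < - r) || (0 < s) -> phi s = 0.
  by move=> s0; apply: phi0; rewrite in_itv/= negb_and -ltNge -leNgt;
     case/orP: s0 => [->|/ltW ->]//; rewrite orbT.
have : (t < - r) || (0 < t).
  move: nit; rewrite in_itv/= negb_and -!leNgt => /orP[tr'|t0'].
    by rewrite lt_neqAle tr tr'.
  by rewrite [0 < t]lt_neqAle eq_sym t0 t0' orbT.
move=> ts; change (phi @ t --> phi t); rewrite (out t ts).
apply: cvg_near_cst; case/orP: ts => ts; near=> s; apply: out; apply/orP.
  by left; near: s; exact: lt_nbhsl.
by right; near: s; exact: lt_nbhsr.
Unshelve. all: by end_near. Qed.

Lemma Chat_bmeasv nu r (phi : R -> 'cV[R]_nu) : 0 < r -> Chat r phi -> bmeasv phi.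
Proof.
move=> r0 Cphi i; split.
  have [E fE [_ _ cE]] := Chat_continuous r0 Cphi.
  apply: (countable_discontinuities_measurable (finite_set_countable fE)) => t NEt.
  exact: continuous_coord (cE t NEt).
move=> c; exists (supnorm r phi) => s _.
exact: le_trans (coord_le_norm _ _) (le_supnorm _ r0 Cphi).
Qed.

Lemma norm_le_state_norm n nu r (x : 'cV[R]_n) (phi : R -> 'cV[R]_nu) :
  `|x| <= state_norm r x phi.
Proof. by rewrite le_max lexx. Qed.

Lemma history_le_state_norm n nu r (x : 'cV[R]_n) (phi : R -> 'cV[R]_nu) theta :
  0 < r -> Chat r phi -> `|phi theta| <= state_norm r x phi.
Proof. by move=> r0 C; rewrite le_max (le_supnorm _ r0 C) orbT. Qed.

End Histories.

(** * The Lyapunov-Krasovskii functional *)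

Section Functional.
Variables (R : realType) (n nu d : nat) (r : R).
Hypothesis r0 : 0 < r.
Variables (P : 'M[R]_(n + d.+1 * nu)) (S U : 'M[R]_nu).
Implicit Types (x h k : 'cV[R]_n) (phi psi chi : R -> 'cV[R]_nu).

Let r0' : - r <= 0. Proof. by rewrite oppr_le0 ltW. Qed.

Lemma Lmx_mulE tau (v : 'cV[R]_nu) (i : 'I_d.+1) a :
  (Lmx d nu r tau *m v) (mxtens_index (i, a)) 0 = legendre r i tau * v a 0.
Proof.
rewrite mxE (bigD1 a)//= big1 ?addr0.
  rewrite /Lmx castmxE cast_ord_id/=.
  have -> : cast_ord (esym (mul1n nu)) a = mxtens_index (0 : 'I_1, a) by apply: val_inj.
  by rewrite tensmxE !mxE eqxx mulr1.
move=> b ba; rewrite /Lmx castmxE cast_ord_id/=.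
have -> : cast_ord (esym (mul1n nu)) b = mxtens_index (0 : 'I_1, b) by apply: val_inj.
by rewrite tensmxE !mxE eq_sym (negbTE ba) mulr0 mul0r.
Qed.

Lemma bmeasv_Lmx phi : bmeasv phi -> bmeasv (fun tau => Lmx d nu r tau *m phi tau).
Proof.
move=> bphi k; case: (mxtens_indexP k) => i a.
under eq_fun do rewrite Lmx_mulE.
by apply: bmeasM => //; exact: bmeas_legendre.
Qed.

(** The Legendre coefficients of a history. *)
Definition Lint phi : 'cV[R]_(d.+1 * nu) :=
  vitg (- r) 0 (fun tau => Lmx d nu r tau *m phi tau).

Lemma LintE phi (i : 'I_d.+1) a : Lint phi (mxtens_index (i, a)) 0 =
  itg (- r) 0 (fun tau => legendre r i tau * phi tau a 0).
Proof. by rewrite mxE; apply: itg_eq => s _; rewrite Lmx_mulE. Qed.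

Lemma subcol_Lint phi i : subcol (Lint phi) i =
  vitg (- r) 0 (fun tau => legendre r i tau *: phi tau).
Proof.
apply/colP => a; rewrite mxE LintE mxE.
by apply: itg_eq => s _; rewrite mxE.
Qed.

Lemma LintD phi psi : bmeasv phi -> bmeasv psi -> Lint (phi + psi) = Lint phi + Lint psi.
Proof.
move=> bphi bpsi; rewrite -vitgD; try exact: bmeasv_Lmx.
by apply: vitg_eq => s _; rewrite -mulmxDr.
Qed.

Lemma LintZ a phi : bmeasv phi -> Lint (a *: phi) = a *: Lint phi.
Proof.
move=> bphi; rewrite -vitgZ; last exact: bmeasv_Lmx.
by apply: vitg_eq => s _; rewrite -scalemxAr.
Qed.

Lemma Lint_eq phi psi : bmeasv phi -> bmeasv psi ->
  (forall tau, - r <= tau < 0 -> phi tau = psi tau) -> Lint phi = Lint psi.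
Proof.
move=> bphi bpsi E; apply/colP => k; rewrite !mxE; apply: itg_eq_co.
- exact: (bmeasv_Lmx bphi).
- exact: (bmeasv_Lmx bpsi).
- by move=> s /E ->.
Qed.

Definition energy phi psi : R :=
  itg (- r) 0 (fun tau => blf (r *: S + (tau + r) *: U) (phi tau) (psi tau)).

Lemma bmeas_energy phi psi : bmeasv phi -> bmeasv psi ->
  bmeas (fun tau => blf (r *: S + (tau + r) *: U) (phi tau) (psi tau)).
Proof.
move=> bphi bpsi; under eq_fun do rewrite blfD !blfZ.
apply: bmeasD; first by apply: bmeasZ; exact: bmeas_blf.
apply: bmeasM; last exact: bmeas_blf.
by apply: bmeasD; [exact: bmeas_id|exact: bmeas_cst].
Qed.

(** The functional is the diagonal of this bilinear form. Its Frechet derivative is the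
sum of the two partial evaluations, and differentiability reduces to boundedness of
the form. *)
Definition lyap_form x phi h psi : R :=
  blf P (col_mx x (Lint phi)) (col_mx h (Lint psi)) + energy phi psi.

Definition lyap x phi : R := lyap_form x phi x phi.

Lemma lyap_eq x phi psi : bmeasv phi -> bmeasv psi ->
  (forall tau, - r <= tau < 0 -> phi tau = psi tau) -> lyap x phi = lyap x psi.
Proof.
move=> bphi bpsi E; rewrite /lyap /lyap_form (Lint_eq bphi bpsi E); congr (_ + _).
apply: itg_eq_co; try exact: bmeas_energy.
by move=> s /E ->.
Qed.

Lemma lyap_form_linear_r x phi a h k psi chi : bmeasv phi -> bmeasv psi -> bmeasv chi ->
  lyap_form x phi (a *: h + k) (a *: psi + chi) =
  a * lyap_form x phi h psi + lyap_form x phi k chi.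
Proof.
move=> bphi bpsi bchi; have ba : bmeasv (a *: psi) by apply: bmeasvZ => //; exact: bmeas_cst.
rewrite /lyap_form LintD// LintZ//.
have -> : col_mx (a *: h + k) (a *: Lint psi + Lint chi) =
   a *: col_mx h (Lint psi) + col_mx k (Lint chi) by rewrite scale_col_mx add_col_mx.
rewrite blfDr blfZr.
have -> : energy phi (a *: psi + chi) = a * energy phi psi + energy phi chi.
  have b1 := bmeas_energy bphi bpsi; have b2 := bmeas_energy bphi bchi.
  rewrite /energy -itgZ// -itgD//; last exact: bmeasZ.
  by apply: itg_eq => s _; rewrite blfDr blfZr.
by rewrite [a * (_ + _)]mulrDr; exact: addrACA.
Qed.

Lemma lyap_form_linear_l x phi a h k psi chi : bmeasv phi -> bmeasv psi -> bmeasv chi ->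
  lyap_form (a *: h + k) (a *: psi + chi) x phi =
  a * lyap_form h psi x phi + lyap_form k chi x phi.
Proof.
move=> bphi bpsi bchi; have ba : bmeasv (a *: psi) by apply: bmeasvZ => //; exact: bmeas_cst.
rewrite /lyap_form LintD// LintZ//.
have -> : col_mx (a *: h + k) (a *: Lint psi + Lint chi) =
   a *: col_mx h (Lint psi) + col_mx k (Lint chi) by rewrite scale_col_mx add_col_mx.
rewrite blfDl blfZl.
have -> : energy (a *: psi + chi) phi = a * energy psi phi + energy chi phi.
  have b1 := bmeas_energy bpsi bphi; have b2 := bmeas_energy bchi bphi.
  rewrite /energy -itgZ// -itgD//; last exact: bmeasZ.
  by apply: itg_eq => s _; rewrite blfDl blfZl.
by rewrite [a * (_ + _)]mulrDr; exact: addrACA.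
Qed.

Lemma lyap_form_bounded : exists2 C : R, 0 <= C &
  forall x phi h psi, Chat r phi -> Chat r psi ->
  `|lyap_form x phi h psi| <= C * (state_norm r x phi * state_norm r h psi).
Proof.
have [Lb Lb0 HL] : exists2 Lb : R, 0 <= Lb &
    forall (i : 'I_d.+1) tau, - r <= tau <= 0 -> `|legendre r i tau| <= Lb.
  have H (i : 'I_d.+1) : {M : R | forall s, `|s| <= r -> `|legendre r i s| <= M}.
    exact: (cid ((bmeas_legendre r i).2 r)).
  exists (\sum_i `|sval (H i)|); first by apply: sumr_ge0.
  move=> i tau /andP[t1 t2]; apply: le_trans (svalP (H i) _ _) _.
    by rewrite ler0_norm// lerNl.
  rewrite (bigD1 i)//=; apply: le_trans (ler_norm _) _.
  by rewrite lerDl; apply: sumr_ge0.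
(* K bounds the map from (x, phi) to (x, Lint phi) for the norm of the state. *)
pose K := Num.max 1 (Lb * r).
have K1 : 1 <= K by rewrite le_max lexx.
have etaK x phi : Chat r phi -> `|col_mx x (Lint phi)| <= K * state_norm r x phi.
  move=> Cphi; have sn0 : 0 <= state_norm r x phi by exact: le_trans (norm_le_state_norm r x phi).
  apply: norm_le_coord => [|i]; first by rewrite mulr_ge0// (le_trans ler01).
  case: (split_ordP i) => j ->.
    rewrite col_mxEu; apply: le_trans (coord_le_norm _ _) _.
    by apply: le_trans (norm_le_state_norm r x phi) _; rewrite ler_peMl.
  rewrite col_mxEd; case: (mxtens_indexP j) => l a; rewrite LintE.
  apply: (@le_trans _ _ (Lb * state_norm r x phi * (0 - - r))).
    apply: itg_norm_le => //.
      by apply: bmeasM; [exact: bmeas_legendre|exact: (Chat_bmeasv r0 Cphi)].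
    move=> s sr; rewrite normrM; apply: ler_pM => //; first exact: HL.
    apply: le_trans (coord_le_norm _ _) _; exact: history_le_state_norm.
  by rewrite sub0r opprK mulrAC ler_wpM2r// le_max lexx orbT.
have K0 : 0 <= K by exact: le_trans ler01 K1.
exists (mxabs P * (K * K) + (r * mxabs S + r * mxabs U) * r).
  by rewrite addr_ge0 ?mulr_ge0 ?addr_ge0 ?mulr_ge0 ?mxabs_ge0// ltW.
move=> x phi h psi Cphi Cpsi.
have sn1 : 0 <= state_norm r x phi by exact: le_trans (norm_le_state_norm r x phi).
have sn2 : 0 <= state_norm r h psi by exact: le_trans (norm_le_state_norm r h psi).
apply: le_trans (ler_normD _ _) _; rewrite mulrDl; apply: lerD.
  apply: le_trans (blf_norm_le _ _ _) _; rewrite -mulrA ler_wpM2l ?mxabs_ge0//.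
  by rewrite mulrACA; apply: ler_pM => //; exact: etaK.
rewrite mulrAC.
have -> : forall a : R, a * r = a * (0 - - r) by move=> a; rewrite sub0r opprK.
apply: itg_norm_le => //.
  by apply: bmeas_energy; exact: (Chat_bmeasv r0).
move=> s /andP[s1 s2]; rewrite blfD !blfZ.
have N : `|phi s| * `|psi s| <= state_norm r x phi * state_norm r h psi.
  by apply: ler_pM => //; exact: history_le_state_norm.
apply: le_trans (ler_normD _ _) _; rewrite !normrM mulrDl; apply: lerD.
  rewrite gtr0_norm// -mulrA ler_wpM2l ?(ltW r0)//.
  apply: le_trans (blf_norm_le _ _ _) _; by rewrite ler_wpM2l ?mxabs_ge0.
rewrite -mulrA; apply: ler_pM => //.
  by rewrite ger0_norm; lra.
apply: le_trans (blf_norm_le _ _ _) _; by rewrite ler_wpM2l ?mxabs_ge0.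
Qed.

Lemma lyap_differentiable : differentiable_functional r lyap.
Proof.
move=> x phi Cphi; have bphi := Chat_bmeasv r0 Cphi.
have [C C0 HC] := lyap_form_bounded.
exists (fun h psi => lyap_form x phi h psi + lyap_form h psi x phi); split.
- move=> a h psi k chi Cpsi Cchi.
  have bpsi := Chat_bmeasv r0 Cpsi; have bchi := Chat_bmeasv r0 Cchi.
  rewrite lyap_form_linear_r// lyap_form_linear_l//.
  move: (lyap_form x phi h psi) (lyap_form h psi x phi).
  move: (lyap_form x phi k chi) (lyap_form k chi x phi) => *; ring.
- exists (2 * (C * state_norm r x phi)) => h psi Cpsi.
  apply: le_trans (ler_normD _ _) _.
  have H1 := HC x phi h psi Cphi Cpsi; have H2 := HC h psi x phi Cpsi Cphi.
  by move: H1 H2; rewrite [state_norm r h psi * _]mulrC !mulrA; lra.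
- move=> e e0; exists (e / (C + 1)); first by rewrite divr_gt0// ltr_wpDl.
  move=> h psi Cpsi sn; have bpsi := Chat_bmeasv r0 Cpsi.
  have -> : lyap (x + h) (phi + psi) - lyap x phi -
     (lyap_form x phi h psi + lyap_form h psi x phi) = lyap_form h psi h psi.
    rewrite /lyap -{1 2}[x]scale1r -{1 2}[phi]scale1r.
    have bs : bmeasv (1 *: phi + psi).
      by apply: bmeasvD => //; apply: bmeasvZ => //; exact: bmeas_cst.
    rewrite lyap_form_linear_r// !lyap_form_linear_l// !mul1r.
    move: (lyap_form x phi x phi) (lyap_form h psi x phi) (lyap_form x phi h psi).
    move: (lyap_form h psi h psi) => *; ring.
  have sn0 : 0 <= state_norm r h psi by exact: le_trans (norm_le_state_norm r h psi).
  apply: le_trans (HC _ _ _ _ Cpsi Cpsi) _; rewrite mulrA ler_wpM2r//.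
  move: sn; rewrite ltr_pdivlMr ?ltr_wpDl// => sn; lra.
Qed.

End Functional.

(** * The functional along a trajectory *)

Section Auxiliary.
Variable R : realType.

Lemma lebesgue_ae_filter : Filter (almost_everywhere (@lebesgue_measure R)).
Proof. exact: ae_filter_ringOfSetsType. Qed.

Lemma continuous_lincomb k (a : 'I_k -> R) (f : 'I_k -> R -> R) (t : R) :
  (forall j, {for t, continuous (f j)}) ->
  {for t, continuous (fun u => \sum_j a j * f j u)}.
Proof.
move=> cf; elim: (index_enum _) => [|j s IH].
  have -> : (fun u => \sum_(j <- [::]) a j * f j u) = (fun=> 0).
    by apply/funext => u; rewrite big_nil.
  exact: cvg_cst.
have -> : (fun u => \sum_(i <- j :: s) a i * f i u) =
    (fun u => a j * f j u + \sum_(i <- s) a i * f i u).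
  by apply/funext => u; rewrite big_cons.
by apply: cvgD => //; apply: cvgM; [exact: cvg_cst|exact: cf].
Qed.

End Auxiliary.

Section Trajectory.
Variables (R : realType) (n nu m q d : nat) (sys : delay_system R n nu m q d).
Variables (r t0 : R) (xi : 'cV[R]_n) (phi : R -> 'cV[R]_nu).
Variables (w : R -> 'cV[R]_q) (x : R -> 'cV[R]_n) (y : R -> 'cV[R]_nu).
Hypotheses (r0 : 0 < r) (Cphi : Chat r phi).
Hypothesis traj : is_trajectory sys r t0 xi phi w x y.
Local Open Scope classical_set_scope.

(** Before [t0 - r] nothing is known about [y], not even measurability; cutting it off
there gives a function on the whole line to which the integration lemmas apply. *)
Definition ycut s : 'cV[R]_nu := if t0 - r <= s then y s else 0.

Lemma ycutE s : t0 - r <= s -> ycut s = y s.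
Proof. by rewrite /ycut => ->. Qed.

Lemma ycut_history s : s < t0 -> ycut s = phi (s - t0).
Proof.
case: traj => _ yphi _ _ st; rewrite /ycut; case: ifPn => [rs|].
  rewrite -yphi; first by congr (y _); ring.
  by rewrite in_itv/=; apply/andP; split; lra.
rewrite -ltNge => sr; case: Cphi => [-> //]; rewrite in_itv/= negb_and -!ltNge.
by apply/orP; left; lra.
Qed.

Lemma ycut_step s : t0 <= s -> ycut s = A4 sys *m x s + A5 sys *m ycut (s - r).
Proof.
case: traj => _ _ yE _ ts; have rp := r0.
have E1 : ycut s = y s by apply: ycutE; lra.
have E2 : ycut (s - r) = y (s - r) by apply: ycutE; lra.
by rewrite E1 E2; exact: yE.
Qed.

(** The method of steps for the difference equation. *)
Lemma step_ind (Q : R -> Prop) : (forall s, s < t0 -> Q s) ->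
  (forall s, t0 <= s -> Q (s - r) -> Q s) -> forall s, Q s.
Proof.
move=> Q0 Qs s.
have H (k : nat) u : u < t0 + k%:R * r -> Q u.
  elim: k u => [|k IH] u; first by rewrite mul0r addr0; exact: Q0.
  rewrite -natr1 mulrDl mul1r addrA => uk.
  have [/Q0//|tu] := ltP u t0; apply: Qs => //; apply: IH; lra.
have := archi_boundP (normr_ge0 ((s - t0) / r)).
move: (Num.bound _) => k /(le_lt_trans (ler_norm _)); rewrite ltr_pdivrMr// => sk.
apply: (H k); lra.
Qed.

Lemma x_continuous t : t0 < t -> {for t, continuous x}.
Proof.
case: traj => -[acx _] _ _ _ t0t.
have t0t1 : t0 <= t + 1 by lra.
have H := abs_continuous_pair (acx _ t0t1).
apply/cvgrPdist_lt => e e0; have [de de0 {}H] := H e e0.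
near=> s.
have st : `|t - s| < Num.min de (Num.min (t - t0) 1).
  near: s; apply: (@nbhsx_ballx _ _ t).
  by rewrite !lt_min de0 subr_gt0 t0t ltr01.
move: st; rewrite !lt_min => /and3P[s1 s2 s3].
have [ts|st] := leP t s.
  rewrite distrC; rewrite distrC ger0_norm ?subr_ge0// in s1 s2 s3.
  apply: H => //; lra.
rewrite ger0_norm ?subr_ge0 ?(ltW st)// in s1 s2 s3.
by apply: H => //; lra.
Unshelve. all: by end_near. Qed.

Lemma x_bounded b : exists M : R, forall t, t0 <= t <= b -> `|x t| <= M.
Proof.
have [tb|bt] := leP t0 b.
  by case: traj => -[acx _] _ _ _; exact: abs_continuous_bounded (acx b tb).
by exists 0 => t /andP[t0t tb]; have := le_lt_trans (le_trans t0t tb) bt; rewrite ltxx.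
Qed.

Lemma ycut_bounded s : exists M : R, forall u, u <= s -> `|ycut u| <= M.
Proof.
have hist u : u < t0 -> `|ycut u| <= supnorm r phi.
  by move=> ut; rewrite ycut_history//; exact: le_supnorm.
move: s; apply: step_ind => [s st|s ts [M yM]].
  by exists (supnorm r phi) => u us; apply: hist; lra.
have [X xX] := x_bounded s.
exists (Num.max (supnorm r phi) (mxabs (A4 sys) * X + mxabs (A5 sys) * M)) => u us.
have [ut|tu] := ltP u t0; rewrite le_max; first by rewrite hist.
apply/orP; right; rewrite ycut_step//; apply: le_trans (ler_normD _ _) _.
apply: lerD; apply: le_trans (norm_mulmx_le _ _) _; rewrite ler_wpM2l ?mxabs_ge0//.
  by apply: xX; rewrite tu.
by apply: yM; lra.
Qed.

(** The difference equation carries a discontinuity of the initial history, or the jump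
at [t0], from each delay interval to the next. *)
Definition breakpoints (E0 : set R) : set R :=
  \bigcup_(j in [set: nat]) [set t0 + e + j%:R * r | e in E0].

Lemma ycut_continuous : exists2 E : set R, countable E &
  forall s, ~ E s -> (t0 != s) /\ forall i, {for s, continuous (fun u => ycut u i 0)}.
Proof.
have [E0 fE0 [Er E00 cE]] := Chat_continuous r0 Cphi.
exists (breakpoints E0).
  apply: bigcup_countable => // j _.
  exact/finite_set_countable/finite_image.
have Et0 : breakpoints E0 t0 by exists 0%N => //; exists 0 => //; rewrite mul0r !addr0.
have Etr : breakpoints E0 (t0 - r) by exists 0%N => //; exists (- r) => //; rewrite mul0r addr0.
move=> s NEs; split; first by apply/eqP => tsE; apply: NEs; rewrite -tsE.
move: s NEs; apply: step_ind => [s st NEs i|s ts IH NEs i].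
  have NE0 : ~ E0 (s - t0).
    by move=> E0s; apply: NEs; exists 0%N => //; exists (s - t0) => //; rewrite mul0r; ring.
  have c1 : {for s, continuous (fun u => phi (- t0 + u) i 0)}.
    apply: (@continuous_comp _ _ _ (fun u => - t0 + u) (fun v => phi v i 0)).
      by apply: cvgD; [exact: cvg_cst|exact: cvg_id].
    by rewrite addrC; exact: continuous_coord (cE _ NE0).
  have E u : u < t0 -> phi (- t0 + u) i 0 = ycut u i 0.
    by move=> ut; rewrite ycut_history// addrC.
  change (ycut u i 0 @[u --> s] --> ycut s i 0).
  rewrite -E//; apply: cvg_trans c1; apply: near_eq_cvg.
  by near=> u; apply: E; near: u; exact: lt_nbhsl.
have ts' : t0 < s by rewrite lt_neqAle ts andbT; apply/eqP => tsE; apply: NEs; rewrite -tsE.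
have NEsr : ~ breakpoints E0 (s - r).
  move=> [j _ [e E0e sE]]; apply: NEs; exists j.+1 => //; exists e => //.
  by rewrite -natr1 mulrDl mul1r; lra.
have cy := IH NEsr.
pose f u := \sum_j A4 sys i j * x u j 0 + \sum_j A5 sys i j * ycut (- r + u) j 0.
have E u : t0 <= u -> f u = ycut u i 0.
  by move=> tu; rewrite /f (ycut_step tu) [u - r]addrC !mxE.
change (ycut u i 0 @[u --> s] --> ycut s i 0).
rewrite -E//; apply: (@cvg_trans _ (nbhs (f @ s))).
  apply: near_eq_cvg; near=> u; apply: E; apply/ltW; near: u; exact: lt_nbhsr.
apply: cvgD; apply: continuous_lincomb => j.
  exact: continuous_coord (x_continuous ts').
apply: (@continuous_comp _ _ _ (fun u => - r + u) (fun v => ycut v j 0)).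
  by apply: cvgD; [exact: cvg_cst|exact: cvg_id].
by rewrite addrC; exact: cy.
Unshelve. all: by end_near. Qed.

Lemma ycut_bmeasv : bmeasv ycut.
Proof.
move=> i; have [E cE HE] := ycut_continuous; split.
  by apply: (countable_discontinuities_measurable cE) => t /HE[].
move=> c; have [M HM] := ycut_bounded c; exists M => s sc.
by apply: le_trans (coord_le_norm _ _) _; apply: HM; apply: le_trans (ler_norm _) sc.
Qed.

(** The functional is differentiable along the trajectory at these times: [x] is, and both
ends of the window [t - r, t] are continuity points of [y]. *)
Definition regular_time : set R := [set t | [/\ t0 < t,
  is_derive t 1 x (xdot_rhs sys r w x y t) &
  forall i, {for t, continuous (fun u => ycut u i 0)} /\
            {for t - r, continuous (fun u => ycut u i 0)}]].

Lemma regular_time_ae : {ae @lebesgue_measure R, forall t, t0 <= t -> regular_time t}.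
Proof.
have [E cE HE] := ycut_continuous.
case: traj => _ _ _ dx.
have nE : {ae @lebesgue_measure R, forall t, ~ E t}.
  exists E; split.
  - exact: countable_measurable.
  - exact: countable_lebesgue_measure0.
  - by move=> t /= /contrapT.
have nEr : {ae @lebesgue_measure R, forall t, ~ E (t - r)}.
  have cEr : countable [set e + r | e in E] by apply: sub_countable cE; exact: card_image_le.
  exists [set e + r | e in E]; split.
  - exact: countable_measurable.
  - exact: countable_lebesgue_measure0.
  - by move=> t /= /contrapT Et; exists (t - r) => //; rewrite subrK.
apply: (@filterS3 _ _ (lebesgue_ae_filter R)) dx nE nEr => t dxt NEt NEtr t0t.
have [t0Nt cy] := HE t NEt; have [_ cyr] := HE _ NEtr.
split; first by rewrite lt_neqAle t0Nt.
- exact: dxt.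
- by move=> i; split; [exact: cy|exact: cyr].
Qed.

Definition hist t : R -> 'cV[R]_nu := fun tau => ycut (t + tau).

Lemma bmeasv_hist t : bmeasv (hist t).
Proof. exact: (bmeasv_shift t ycut_bmeasv). Qed.

Lemma distributed_delayE k (M : 'M[R]_(k, d.+1 * nu)) t : t0 <= t ->
  distributed_delay M r y t = M *m Lint d r (hist t).
Proof.
move=> t0t; have b := @bmeasv_Lmx R nu d r _ (bmeasv_hist t).
have r0' : - r <= 0 by rewrite oppr_le0 ltW.
rewrite /Lint -vitg_mul//; apply/colP => i; rewrite !mxE.
apply: itg_eq => s /andP[s1 s2]; rewrite /hist ycutE ?mulmxA//; lra.
Qed.

(** The vector of the quadratic form of the matrix inequality. *)
Definition chi_vec t : 'cV[R]_(q + (n + (nu + d.+1 * nu))) :=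
  col_mx (w t) (col_mx (x t) (col_mx (y (t - r)) (r^-1 *: Lint d r (hist t)))).

Definition eta_vec t : 'cV[R]_(n + d.+1 * nu) := col_mx (x t) (Lint d r (hist t)).

Lemma y_Gamma t : t0 <= t -> y t = Gamma_mx sys *m chi_vec t.
Proof.
case: traj => _ _ yE _ t0t; rewrite yE// /Gamma_mx /chi_vec !mul_row_col.
by rewrite !mul0mx addr0 add0r.
Qed.

Lemma output_Sigma t : t0 <= t -> output sys r w x y t = Sigma_mx sys r *m chi_vec t.
Proof.
move=> t0t; rewrite /output distributed_delayE// /Sigma_mx /chi_vec !mul_row_col.
rewrite -scalemxAl -scalemxAr scalerA divff ?gt_eqF// scale1r.
by rewrite [RHS]addrC !addrA.
Qed.

Lemma eta_Phi_left t : eta_vec t = (Phi_left n nu q d r)^T *m chi_vec t.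
Proof.
rewrite /Phi_left /chi_vec !tr_col_mx !tr_row_mx !trmx0 !mul_row_col !mul_col_mx.
rewrite !mul0mx !trmx1 !tr_scalar_mx mul1mx mul_scalar_mx scalerA divff ?gt_eqF//.
by rewrite scale1r !add_col_mx !addr0 !add0r.
Qed.

Variable Lac : 'M[R]_d.+1.
Hypothesis hLac : is_legendre_derivative_mx Lac.


Let legr (i : 'I_d.+1) : {poly R} := legp R i \Po (r^-1 *: 'X).

Let horner_legr i tau : (legr i).[tau] = legendre r i tau.
Proof. by rewrite /legr horner_comp hornerZ hornerX -horner_legp mulrC. Qed.

Lemma deriv_legr i tau :
  (legr i)^`().[tau] = r^-1 * \sum_j Lac i j * legendre r j tau.
Proof.
have H := is_derive_coord i (hLac tau r0).
have E : (fun s => ellvec d r s i 0) = horner (legr i).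
  by apply/funext => s; rewrite mxE horner_legr.
rewrite E in H; rewrite derivE derive1E (@derive_val _ _ _ _ _ _ _ H) mxE mxE.
by congr (_ * _); apply: eq_bigr => j _; rewrite mxE.
Qed.

Lemma moment_legr (i : 'I_d.+1) a t :
  moment r (legr i) (fun s => ycut s a 0) t = Lint d r (hist t) (mxtens_index (i, a)) 0.
Proof. by rewrite LintE; apply: itg_eq => s _; rewrite horner_legr. Qed.

Lemma moment_deriv_legr (i : 'I_d.+1) a t :
  moment r (legr i)^`() (fun s => ycut s a 0) t =
  r^-1 * \sum_j Lac i j * Lint d r (hist t) (mxtens_index (j, a)) 0.
Proof.
have b j : bmeas (fun tau => legendre r j tau * hist t tau a 0).
  by apply: bmeasM; [exact: bmeas_legendre|exact: (bmeasv_hist t a)].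
have r0' : - r <= 0 by rewrite oppr_le0 ltW.
under [in RHS]eq_bigr do rewrite LintE -itgZ//.
rewrite -itg_sum//; last by move=> j; exact: bmeasZ.
rewrite -itgZ; last by apply: bmeas_sum => j; exact: bmeasZ.
apply: itg_eq => s _; rewrite deriv_legr -mulrA mulr_suml; congr (_ * _).
by apply: eq_bigr => j _; rewrite mulrA.
Qed.

Lemma Lhat_mulE (v : 'cV[R]_(d.+1 * nu)) (i : 'I_d.+1) a :
  (Lhat nu Lac *m v) (mxtens_index (i, a)) 0 =
  \sum_j Lac i j * v (mxtens_index (j, a)) 0.
Proof.
rewrite mxE sum_mxtens; apply: eq_bigr => j _.
rewrite (bigD1 a)//= big1 ?addr0 => [|b ba]; rewrite tensmxE mxE.
  by rewrite eqxx mulr1.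
by rewrite eq_sym (negbTE ba) mulr0 mul0r.
Qed.

(** The derivative of the Legendre coefficients of the history is again linear in the
vector [chi_vec], because the derivatives of Legendre polynomials are combinations of
Legendre polynomials. *)
Lemma acd_eta k : acd t0 regular_time (fun t => eta_vec t k 0)
  (fun t => (Phi_right sys Lac r *m chi_vec t) k 0).
Proof.
have reg_gt t : regular_time t -> t0 < t by case.
case: (split_ordP k) => j ->.
  have E t : regular_time t ->
      (Phi_right sys Lac r *m chi_vec t) (lshift _ j) 0 = xdot_rhs sys r w x y t j 0.
    move=> [t0t _ _]; rewrite /Phi_right /chi_vec mul_col_mx col_mxEu !mul_row_col.
    rewrite /xdot_rhs distributed_delayE ?(ltW t0t)// -scalemxAl -scalemxAr scalerA.
    by rewrite divff ?gt_eqF// scale1r; congr (fun_of_matrix _ j 0); rewrite [LHS]addrC !addrA.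
  split=> [b t0b|t Gt].
    apply: (@abs_continuous_eq _ _ _ _ (fun t => x t j 0)).
      by move=> t _; rewrite col_mxEu.
    by apply: abs_continuous_coord; case: traj => -[acx _] _ _ _; exact: acx.
  rewrite E//; case: Gt => _ dxt _.
  have := is_derive_coord j dxt.
  by congr (is_derive t 1 _ _); apply/funext => s; rewrite col_mxEu.
case: (mxtens_indexP j) => i a.
have A := acd_moment reg_gt r0 (legr i) (ycut_bmeasv a).
have {}A := A (fun t Gt => let: And3 _ _ c := Gt in c a).
apply: acd_eq A => // t.
  by move=> _; rewrite moment_legr col_mxEd.
move=> [t0t _ _]; rewrite moment_deriv_legr !horner_legr.
rewrite /Phi_right /chi_vec mul_col_mx col_mxEd !mul_row_col mul0mx add0r mulmxBl.
rewrite -!mulmxA mulNmx -scalemxAr.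
have -> : Lmx d nu r 0 *m (A4 sys *m x t) + (Lmx d nu r 0 *m (A5 sys *m y (t - r)) -
    Lmx d nu r (- r) *m y (t - r) - r^-1 *: (Lhat nu Lac *m Lint d r (hist t))) =
    Lmx d nu r 0 *m y t - Lmx d nu r (- r) *m y (t - r) -
      r^-1 *: (Lhat nu Lac *m Lint d r (hist t)).
  have -> : y t = A4 sys *m x t + A5 sys *m y (t - r).
    by case: traj => _ _ yE _; apply: yE; exact: ltW.
  by rewrite mulmxDr !addrA.
rewrite !ycutE; [|by have := r0; lra|by have := r0; lra].
have xN (u v : 'cV[R]_(d.+1 * nu)) l : (u - v) l 0 = u l 0 - v l 0 by rewrite !mxE.
by rewrite !xN !Lmx_mulE [X in _ = _ - X]mxE Lhat_mulE.
Qed.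

Lemma acd_blf k l (A : 'M[R]_(k, l)) (u u' : R -> 'cV[R]_k) (v v' : R -> 'cV[R]_l) :
  (forall i, acd t0 regular_time (fun t => u t i 0) (fun t => u' t i 0)) ->
  (forall i, acd t0 regular_time (fun t => v t i 0) (fun t => v' t i 0)) ->
  acd t0 regular_time (fun t => blf A (u t) (v t))
    (fun t => blf A (u' t) (v t) + blf A (u t) (v' t)).
Proof.
have reg_gt t : regular_time t -> t0 < t by case.
move=> du dv.
have D i j := acdM (acdM (du i) (acd_cst _ _ (A i j))) (dv j).
apply: (acd_eq reg_gt) (acd_sum reg_gt (index_enum 'I_k)
  (fun i => acd_sum reg_gt (index_enum 'I_l) (fun j => D i j))).
  by move=> t _; rewrite blfE.
move=> t _; rewrite !blfE -big_split; apply: eq_bigr => i _ /=.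
by rewrite -big_split; apply: eq_bigr => j _ /=; ring.
Qed.

Variables (P : 'M[R]_(n + d.+1 * nu)) (S U : 'M[R]_nu).

Definition lyap_rate t : R :=
  blf P (Phi_right sys Lac r *m chi_vec t) (eta_vec t) +
  blf P (eta_vec t) (Phi_right sys Lac r *m chi_vec t) +
  (r * qf S (y t) - r * qf S (y (t - r)) +
   (r * qf U (y t) - itg (- r) 0 (fun tau => qf U (hist t tau)))).

Lemma acd_lyap_hist :
  acd t0 regular_time (fun t => lyap r P S U (x t) (hist t)) lyap_rate.
Proof.
have reg_gt t : regular_time t -> t0 < t by case.
have bq A : bmeas (fun s => qf A (ycut s)) by apply: bmeas_blf; exact: ycut_bmeasv.
have cq A t : regular_time t -> {for t, continuous (fun s => qf A (ycut s))} /\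
    {for t - r, continuous (fun s => qf A (ycut s))}.
  move=> [_ _ cy]; have H s : (forall i, {for s, continuous (fun u => ycut u i 0)}) ->
      {for s, continuous (fun s => qf A (ycut s))}.
    move=> c; have E : (fun s => qf A (ycut s)) =
        (fun s => \sum_i 1 * \sum_j A i j * (ycut s i 0 * ycut s j 0)).
      apply/funext => u; rewrite blfE; apply: eq_bigr => i _.
      by rewrite mul1r; apply: eq_bigr => j _; ring.
    rewrite E; apply: continuous_lincomb => i; apply: continuous_lincomb => j.
    exact: (cvgM (c i) (c j)).
  by split; apply: H => i; case: (cy i).
have A1 := acd_blf P acd_eta acd_eta.
have A2 := acdZ reg_gt r (acd_moment reg_gt r0 1 (bq S) (cq S)).
have A3 := acd_moment reg_gt r0 ('X + r%:P) (bq U) (cq U).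
apply: (acd_eq reg_gt) (acdD A1 (acdD A2 A3)).
  move=> t _; rewrite /lyap /lyap_form; congr (_ + _).
  have bh A : bmeas (fun tau => qf A (hist t tau)) by exact: (bmeas_shift t (bq A)).
  rewrite /moment -itgZ; last by apply: bmeasM; [exact: bmeas_horner|exact: bh].
  rewrite -itgD; first last.
  - by apply: bmeasM; [exact: bmeas_horner|exact: bh].
  - by apply: bmeasZ; apply: bmeasM; [exact: bmeas_horner|exact: bh].
  apply: itg_eq => s _; rewrite [RHS]blfD !blfZ hornerD hornerX hornerC -polyC1 hornerC mul1r.
  by [].
move=> t [t0t _ _]; rewrite /lyap_rate !ycutE; [|by have := r0; lra|by have := r0; lra].
congr (_ + (_ + _)).
  rewrite -polyC1 derivC !hornerE /moment (@itg_eq _ _ _ _ (fun=> 0))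
    ?itg_cst ?oppr_le0 ?(ltW r0)//.
    by rewrite mul0r subr0 mulrBr ?mul1r.
  by move=> s _; rewrite horner0 mul0r.
rewrite !hornerE addNr mul0r subr0 derivD derivX derivC addr0; congr (_ - _).
by apply: itg_eq => s _; rewrite hornerC mul1r.
Qed.

Lemma bmeasv_segment t : t0 <= t -> bmeasv (segment r y t).
Proof.
move=> t0t i; have -> : (fun s => segment r y t s i 0) =
    (fun s => (\1_(`[- r, 0[) s : R) * hist t s i 0).
  apply/funext => s; rewrite /segment /patch indicE; case: ifPn => [|_].
    rewrite inE/= in_itv/= => /andP[s1 s2]; rewrite mul1r /hist ycutE//; lra.
  by rewrite mul0r mxE.
apply: bmeasM; last exact: (bmeasv_hist t i).
split; first exact: measurable_indic.
by move=> c; exists 1 => s _; rewrite indicE; case: (_ \in _); rewrite ?normr1 ?normr0.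
Qed.

Lemma lyap_segment t : t0 <= t ->
  lyap r P S U (x t) (segment r y t) = lyap r P S U (x t) (hist t).
Proof.
move=> t0t; apply: lyap_eq; [exact: bmeasv_segment|exact: bmeasv_hist|].
move=> s /andP[s1 s2]; rewrite /segment /patch mem_set/= ?in_itv/= ?s1//.
rewrite /hist ycutE//; lra.
Qed.

Lemma acd_lyap :
  acd t0 regular_time (fun t => lyap r P S U (x t) (segment r y t)) lyap_rate.
Proof.
have reg_gt t : regular_time t -> t0 < t by case.
apply: (acd_eq reg_gt) acd_lyap_hist => // t t0t.
by rewrite lyap_segment.
Qed.

End Trajectory.

(** * The matrix inequality *)

Section MatrixInequality.
Variables (R : realType) (n nu m q d : nat) (sys : delay_system R n nu m q d).
Variables (r : R) (Lac : 'M[R]_d.+1).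
Variables (J1 Jt : 'M[R]_m) (J2 : 'M[R]_(m, q)) (J3 : 'M[R]_q).
Variables (P : 'M[R]_(n + d.+1 * nu)) (S U : 'M[R]_nu).

(** [Phi_mx] at a fixed delay, the matrix polynomials being replaced by their
values. *)
Definition Phi_val : 'M[R]_(q + (n + (nu + d.+1 * nu))) :=
  Sy (Phi_left n nu q d r *m P *m Phi_right sys Lac r)
  + (Gamma_mx sys)^T *m (r *: S + r *: U) *m Gamma_mx sys
  - dsum J3 (dsum (0 : 'M[R]_n) (dsum (r *: S) (r *: (Dmx R d *t U))))
  - Sy (row_mx ((Sigma_mx sys r)^T *m J2) 0).

Definition block_val : 'M[R]_(m + (q + (n + (nu + d.+1 * nu)))) :=
  block_mx J1 (Jt *m Sigma_mx sys r) (Jt *m Sigma_mx sys r)^T Phi_val.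

Lemma qf_Phi_val w x yr z (chi := col_mx w (col_mx x (col_mx yr z))) :
  qf Phi_val chi =
  2 * blf P ((Phi_left n nu q d r)^T *m chi) (Phi_right sys Lac r *m chi)
  + r * (qf S (Gamma_mx sys *m chi) + qf U (Gamma_mx sys *m chi))
  - (qf J3 w + (r * qf S yr + r * qf (Dmx R d *t U) z))
  - 2 * blf J2 (Sigma_mx sys r *m chi) w.
Proof.
rewrite /Phi_val 3!blfD !blfN !blf_Sy; congr (_ + _ - _ - _).
- by rewrite blf_mul trmxK.
- by rewrite -blf_mul blfD !blfZ mulrDr.
- by rewrite !qf_dsum blf0 add0r !blfZ.
- congr (_ * _); rewrite /blf -mulmxA /chi mul_row_col mul0mx addr0.
  by rewrite trmx_mul !mulmxA.
Qed.

Lemma supply_rateE z w : supply_rate J1 Jt J2 J3 z w =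
  qf (invmx J1) (Jt *m z) + 2 * blf J2 z w + qf J3 w.
Proof.
rewrite /supply_rate -/(blf _ _ _) blf_col -blf_mul blf_tr; ring.
Qed.

(** This is the Schur complement of the block J1, obtained by evaluating the form of the
opposite of the block matrix at its minimizer - J1^-1 Jt Sigma chi in the first
component. *)
Lemma Phi_val_coercive : J1^T = J1 -> J1 \in unitmx -> posdefmx (- block_val) ->
  exists2 e : R, 0 < e & forall chi,
    qf Phi_val chi - qf (invmx J1) (Jt *m (Sigma_mx sys r *m chi)) <= - (e * sqn chi).
Proof.
move=> sJ1 uJ1 /posdef_coercive[e e0 He]; exists e => // chi.
set v := Jt *m (Sigma_mx sys r *m chi).
have := He (col_mx (- (invmx J1 *m v)) chi).
rewrite blfN blf_col blf_tr.
have -> : qf J1 (- (invmx J1 *m v)) = qf (invmx J1) v.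
  rewrite blfNl blfNr opprK blf_mul trmx_inv sJ1.
  by rewrite mulVmx// mul1mx.
have -> : blf (Jt *m Sigma_mx sys r) (- (invmx J1 *m v)) chi = - qf (invmx J1) v.
  rewrite blfNl; congr (- _).
  by rewrite /blf trmx_mul trmx_inv sJ1 /v !mulmxA.
rewrite sqn_col mulrDr => H.
have := sqn_ge0 (- (invmx J1 *m v)) => /(mulr_ge0 (ltW e0)); lra.
Qed.

Hypothesis r0 : 0 < r.

Lemma Phi_left_yr yr : (Phi_left n nu q d r)^T *m
    (col_mx 0 (col_mx 0 (col_mx yr 0)) : 'cV_(q + (n + (nu + d.+1 * nu)))) = 0.
Proof.
rewrite /Phi_left !tr_col_mx !tr_row_mx !trmx0 !mul_row_col !mul_col_mx.
by rewrite !mul0mx !mulmx0 !add_col_mx !addr0 col_mx0.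
Qed.

(** The diagonal block of the delayed output, which carries the asymptotic stability
of the difference equation y(t) = A5 y(t - r). *)
Lemma difference_contraction : psd S -> psd U -> posdefmx (- block_val) ->
  exists2 e : R, 0 < e & forall u, e * sqn u <= qf S u - qf S (A5 sys *m u).
Proof.
move=> pS pU /posdef_coercive[e e0 He]; exists (e / r); first exact: divr_gt0.
move=> u; rewrite mulrAC ler_pdivrMr//.
have := He (col_mx 0 (col_mx 0 (col_mx 0 (col_mx u 0)))).
rewrite blfN blf_col !blf0l blf0r !add0r qf_Phi_val Phi_left_yr blf0l !blf0l !blf0r !sqn_col.
have sqn0 k : sqn (0 : 'cV[R]_k) = 0 by rewrite sqnE blf0l.
rewrite !sqn0 /Gamma_mx !mul_row_col !mulmx0 !add0r !addr0.
have := pU (A5 sys *m u); move/(mulr_ge0 (ltW r0)); lra.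
Qed.

(** The distributed term of the derivative absorbs the last diagonal block by the
Bessel-Legendre inequality; what the strict matrix inequality leaves over pays for
the perturbation of [U] by [s%:M]. *)
Lemma strict_dissipation : P^T = P -> psd U -> J1^T = J1 -> J1 \in unitmx ->
  posdefmx (- block_val) ->
  exists e s : R, [/\ 0 < e, 0 < s & forall w x (phi : R -> 'cV[R]_nu) yr,
    bmeasv phi ->
    let chi := col_mx w (col_mx x (col_mx yr (r^-1 *: Lint d r phi))) in
    let eta := col_mx x (Lint d r phi) in
    let etad := Phi_right sys Lac r *m chi in
    let yt := Gamma_mx sys *m chi in
    (Phi_left n nu q d r)^T *m chi = eta ->
    blf P etad eta + blf P eta etad + (r * qf S yt - r * qf S yr +
     (r * qf (U + s%:M) yt - itg (- r) 0 (fun tau => qf (U + s%:M) (phi tau))))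
    - supply_rate J1 Jt J2 J3 (Sigma_mx sys r *m chi) w
    <= - (e * sqn chi) - s * itg (- r) 0 (fun tau => sqn (phi tau))].
Proof.
move=> sP pU sJ1 uJ1 pB; have [e e0 He] := Phi_val_coercive sJ1 uJ1 pB.
pose K := mxabs ((Gamma_mx sys)^T *m 1%:M *m Gamma_mx sys).
have K0 : 0 <= K by exact: mxabs_ge0.
have rK : 0 < r * K + 1 by rewrite ltr_wpDl// mulr_ge0// ltW.
(* With this choice s * r * K <= e / 2, so the perturbation costs half of the margin. *)
pose s := e / (2 * (r * K + 1)).
have s0 : 0 < s by rewrite divr_gt0// mulr_gt0.
exists (e / 2), s; split => //; first by rewrite divr_gt0.
move=> w x phi yr bphi chi eta etad yt Eeta.
have bq A : bmeas (fun tau => qf A (phi tau)) by exact: bmeas_blf.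
have bs : bmeas (fun tau => sqn (phi tau)).
  by under eq_fun do rewrite sqnE; exact: bq.
have -> : itg (- r) 0 (fun tau => qf (U + s%:M) (phi tau)) =
    itg (- r) 0 (fun tau => qf U (phi tau)) + s * itg (- r) 0 (fun tau => sqn (phi tau)).
  rewrite -itgZ// -itgD//; last exact: bmeasZ.
  by apply: itg_eq => tau _; rewrite blfD qf_scalar.
have bessel := bessel_legendre r0 d pU bphi.
have {bessel}bessel : r * qf (Dmx R d *t U) (r^-1 *: Lint d r phi) <=
    itg (- r) 0 (fun tau => qf U (phi tau)).
  apply: le_trans bessel; rewrite blfZl blfZr mulrA divff ?gt_eqF// mul1r.
  rewrite qf_Dmx_tens ler_wpM2l ?invr_ge0 ?(ltW r0)// le_eqVlt; apply/orP; left.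
  by apply/eqP; apply: eq_bigr => i _; rewrite subcol_Lint.
have yK : sqn yt <= K * sqn chi by rewrite sqnE blf_mul; exact: qf_le_sqn.
have sK : s * r * (K * sqn chi) <= e / 2 * sqn chi.
  rewrite mulrA ler_wpM2r ?sqn_ge0// /s.
  have -> : e / (2 * (r * K + 1)) * r * K = e / 2 * ((r * K) / (r * K + 1)).
    by field; rewrite gt_eqF.
  rewrite ler_piMr ?divr_ge0 ?(ltW e0)// ler_pdivrMr//; lra.
have := He chi; rewrite qf_Phi_val Eeta -/etad -/yt supply_rateE.
have -> : blf P etad eta = blf P eta etad by rewrite -[in LHS]sP blf_tr.
rewrite blfD qf_scalar.
have sr : s * r * sqn yt <= s * r * (K * sqn chi).
  by rewrite ler_wpM2l// mulr_ge0// ltW.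
move: bessel sK sr.
set I1 := itg _ _ _; set I2 := itg _ _ _.
set X1 := blf P _ _; set X2 := qf S yt; set X3 := qf U yt; set X4 := sqn yt.
set X5 := sqn chi; set X6 := qf S yr; set X7 := qf _ (r^-1 *: _); set X8 := qf (invmx J1) _.
set X9 := blf J2 _ _; set X10 := qf J3 _.
clearbody I1 I2 X1 X2 X3 X4 X5 X6 X7 X8 X9 X10 s K.
rewrite !mulrDr !mulrA; lra.
Qed.

Hypotheses (pS : psd S) (pU : psd U).
Hypothesis pP : posdefmx (P + dsum (0 : 'M[R]_n) (Dmx R d *t S)).

Let energy_split (phi : R -> 'cV[R]_nu) : bmeasv phi -> energy r S U phi phi =
  r * itg (- r) 0 (fun tau => qf S (phi tau)) +
  itg (- r) 0 (fun tau => (tau + r) * qf U (phi tau)).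
Proof.
move=> bphi; have bq A : bmeas (fun tau => qf A (phi tau)) by exact: bmeas_blf.
rewrite -itgZ// -itgD.
- by apply: itg_eq => tau _; rewrite blfD !blfZ.
- exact: bmeasZ.
- by apply: bmeasM => //; apply: bmeasD; [exact: bmeas_id|exact: bmeas_cst].
Qed.

(** By the Bessel-Legendre inequality the integral of the S-energy dominates D (x) S at the
Legendre coefficients. This is why positivity is asked of P + (0 (+) D (x) S) and not
of P itself. *)
Lemma lyap_lower : exists2 e : R, 0 < e & forall x (phi : R -> 'cV[R]_nu), bmeasv phi ->
  e * sqn x <= lyap r P S U x phi.
Proof.
have [e e0 He] := posdef_coercive pP; exists e => // x phi bphi.
have := He (col_mx x (Lint d r phi)).
rewrite blfD qf_dsum blf0 add0r sqn_col mulrDr => H.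
have bessel := bessel_legendre r0 d pS bphi.
have {}bessel : qf (Dmx R d *t S) (Lint d r phi) <= r * itg (- r) 0 (fun tau => qf S (phi tau)).
  rewrite -ler_pdivrMl//; apply: le_trans bessel.
  rewrite qf_Dmx_tens ler_wpM2l ?invr_ge0 ?(ltW r0)// le_eqVlt; apply/orP; left.
  by apply/eqP; apply: eq_bigr => i _; rewrite subcol_Lint.
rewrite /lyap /lyap_form energy_split//.
have Upos : 0 <= itg (- r) 0 (fun tau => (tau + r) * qf U (phi tau)).
  by apply: itg_ge0 => tau /andP[t1 t2]; apply: mulr_ge0; [lra|exact: pU].
have := mulr_ge0 (ltW e0) (sqn_ge0 (Lint d r phi)); lra.
Qed.

(** The Legendre coefficients are bounded by the L2 norm of the history, again by the
Bessel-Legendre inequality, now for the identity matrix. *)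
Lemma lyap_upper : exists2 C : R, 0 < C & forall x (phi : R -> 'cV[R]_nu), bmeasv phi ->
  lyap r P S U x phi <= C * (sqn x + itg (- r) 0 (fun tau => sqn (phi tau))).
Proof.
have p0 := mxabs_ge0 P; have s0 := mxabs_ge0 S; have u0 := mxabs_ge0 U.
pose C := mxabs P * (1 + r) + r * mxabs S + r * mxabs U + 1.
have C0 : 0 < C by rewrite ltr_wpDl// !addr_ge0// mulr_ge0 ?addr_ge0// ltW.
exists C => // x phi bphi.
have bs : bmeas (fun tau => sqn (phi tau)).
  by under eq_fun do rewrite sqnE; exact: bmeas_blf.
have p1 : psd (1%:M : 'M[R]_nu) by exact: psd_scalar.
have bessel := bessel_legendre r0 d p1 bphi.
have I0 : 0 <= itg (- r) 0 (fun tau => sqn (phi tau)) by apply: itg_ge0 => *; exact: sqn_ge0.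
have LI : sqn (Lint d r phi) <= r * itg (- r) 0 (fun tau => sqn (phi tau)).
  rewrite -ler_pdivrMl//.
  have -> : itg (- r) 0 (fun tau => sqn (phi tau)) = itg (- r) 0 (fun tau => qf 1%:M (phi tau)).
    by apply: itg_eq => tau _; rewrite sqnE.
  apply: le_trans bessel; rewrite ler_wpM2l ?invr_ge0 ?(ltW r0)// sqn_subcol.
  apply: ler_sum => i _; rewrite -subcol_Lint -sqnE ler_peMl ?sqn_ge0//.
  by rewrite ler1n addn1.
rewrite /lyap /lyap_form.
have H1 : qf P (col_mx x (Lint d r phi)) <= mxabs P * (sqn x + sqn (Lint d r phi)).
  by rewrite -sqn_col; exact: qf_le_sqn.
have H2 : energy r S U phi phi <=
    (r * mxabs S + r * mxabs U) * itg (- r) 0 (fun tau => sqn (phi tau)).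
  rewrite -itgZ//; apply: itg_le.
  - exact: bmeas_energy.
  - exact: bmeasZ.
  move=> tau /andP[t1 t2]; rewrite blfD !blfZ [leRHS]mulrDl -!mulrA; apply: lerD.
    by rewrite ler_wpM2l ?(ltW r0)//; exact: qf_le_sqn.
  apply: (@le_trans _ _ (r * qf U (phi tau))).
    by rewrite ler_wpM2r ?pU//; lra.
  by rewrite ler_wpM2l ?(ltW r0)//; exact: qf_le_sqn.
have H3 : mxabs P * (sqn x + sqn (Lint d r phi)) <=
    mxabs P * (sqn x + r * itg (- r) 0 (fun tau => sqn (phi tau))).
  by rewrite ler_wpM2l// lerD2l.
have x0 := sqn_ge0 x.
move: p0 s0 u0 H1 H2 H3 I0 x0; rewrite /C.
set I := itg _ _ _; set X := sqn x; set E := energy _ _ _ _ _; set Q := qf P _; set Y := sqn _.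
set p := mxabs P; set a := mxabs S; set b := mxabs U.
clearbody I X E Q Y p a b.
have r0' := ltW r0.
move=> p0 s0 u0 H1 H2 H3 I0 x0.
have h1 : 0 <= p * I by rewrite mulr_ge0.
have h2 : 0 <= p * r * X by rewrite !mulr_ge0.
have h3 : 0 <= r * a * X by rewrite !mulr_ge0.
have h4 : 0 <= r * b * X by rewrite !mulr_ge0.
lra.
Qed.

End MatrixInequality.

(** * Asymptotic stability *)

Section Stability.
Variable R : realType.

Lemma expr_lt_eventually (th e : R) : 0 <= th < 1 -> 0 < e -> exists k : nat, th ^+ k < e.
Proof.
move=> /andP[th0 th1] e0.
have H : ((fun k : nat => th ^+ k) @ \oo --> (0 : R))%classic by apply: cvg_expr; rewrite ger0_norm.
move/cvgrPdist_lt : H => /(_ e e0)[k _ Hk].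
exists k; have := Hk k (leqnn k); rewrite /= sub0r normrN ger0_norm//.
exact: exprn_ge0.
Qed.

Variables (n nu m q d : nat) (sys : delay_system R n nu m q d).
Variables (r : R) (Lac : 'M[R]_d.+1).
Variables (P : 'M[R]_(n + d.+1 * nu)) (S U : 'M[R]_nu).
Hypothesis hLac : is_legendre_derivative_mx Lac.
Hypothesis r0 : 0 < r.
Variables (e1 C c e2 : R).
Hypotheses (e1_gt0 : 0 < e1) (C_gt0 : 0 < C) (c_gt0 : 0 < c) (e2_gt0 : 0 < e2).
Hypothesis lower : forall x (phi : R -> 'cV[R]_nu), bmeasv phi ->
  e1 * sqn x <= lyap r P S U x phi.
Hypothesis upper : forall x (phi : R -> 'cV[R]_nu), bmeasv phi ->
  lyap r P S U x phi <= C * (sqn x + itg (- r) 0 (fun tau => sqn (phi tau))).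
Hypothesis decay : forall t0 xi phi x y, Chat r phi ->
  is_trajectory sys r t0 xi phi (fun=> 0) x y -> forall t,
  regular_time sys r t0 (fun=> 0) x y t ->
  lyap_rate sys r t0 (fun=> 0) x y Lac P S U t <=
  - (c * lyap r P S U (x t) (segment r y t)).
Hypothesis pS : psd S.
Hypothesis contraction : forall u, e2 * sqn u <= qf S u - qf S (A5 sys *m u).

(** An integral form of exponential decay that needs no exponential: while the
functional is at least its final value v, it decreases at rate c v. *)
Lemma lyap_decay t0 xi phi x y : Chat r phi ->
  is_trajectory sys r t0 xi phi (fun=> 0) x y -> forall t, t0 <= t ->
  lyap r P S U (x t) (segment r y t) * (1 + c * (t - t0)) <= lyap r P S U xi phi.
Proof.
move=> Cphi traj t t0t.
set V := fun t => lyap r P S U (x t) (segment r y t).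
have [acV dV] := acd_lyap r0 Cphi traj hLac P S U.
have reg_ae := regular_time_ae r0 Cphi traj.
have V0 s : t0 <= s -> 0 <= V s.
  move=> t0s; apply: le_trans (lower _ _); last exact: (bmeasv_segment r0 Cphi traj).
  by rewrite mulr_ge0 ?sqn_ge0// ltW.
have Vdecr a b : t0 <= a -> a <= b -> V b <= V a.
  move=> t0a ab; apply: abs_continuous_nonincreasing => //.
    by apply: abs_continuous_sub (acV b (le_trans t0a ab)).
  apply: (@filterS _ _ (lebesgue_ae_filter R)) reg_ae => s Hs as_ sb.
  have t0s : t0 <= s by exact: le_trans t0a (ltW as_).
  exists (lyap_rate sys r t0 (fun=> 0) x y Lac P S U s); first exact: dV (Hs t0s).
  apply: le_trans (decay Cphi traj (Hs t0s)) _.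
  by rewrite oppr_le0; apply: mulr_ge0; [exact: ltW|exact: V0].
have Vt0 : V t0 = lyap r P S U xi phi.
  case: (traj) => -[_ x0] yphi _ _; rewrite /V x0; congr (lyap _ _ _ _ _ _).
  apply/funext => s; rewrite /segment /patch; case: ifPn => [|/negP].
    by rewrite inE/= => /yphi.
  rewrite inE/= => /negP sr; by case: Cphi => [->].
rewrite -Vt0.
pose f s := V s + (c * V t) * (s - t0).
suff : f t <= f t0 by rewrite /f subrr mulr0 addr0 -/(V t); lra.
have acl : acd t0 (regular_time sys r t0 (fun=> 0) x y)
    (fun s => (c * V t) * (s - t0)) (fun=> c * V t).
  have reg_gt s : regular_time sys r t0 (fun=> 0) x y s -> t0 < s by case.
  apply: (acd_eq reg_gt) (acdZ reg_gt (c * V t)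
    (acdB reg_gt (acd_id _ _) (acd_cst _ _ t0))) => // s _.
  by rewrite subr0 mulr1.
have [acf df] := acdD (conj acV dV) acl.
apply: abs_continuous_nonincreasing => //; first exact: acf.
apply: (@filterS _ _ (lebesgue_ae_filter R)) reg_ae => s Hs t0s st.
exists (lyap_rate sys r t0 (fun=> 0) x y Lac P S U s + c * V t); first exact: df (Hs (ltW t0s)).
have := decay Cphi traj (Hs (ltW t0s)).
have : c * V t <= c * V s by rewrite ler_pM2l//; apply: Vdecr; exact: ltW.
rewrite /V; lra.
Qed.

Lemma lyap_initial : exists2 K : R, 0 < K & forall (xi : 'cV[R]_n) phi, Chat r phi ->
  lyap r P S U xi phi <= K * state_norm r xi phi ^+ 2.
Proof.
pose K := C * (n%:R + nu%:R * r) + 1.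
have nn k : 0 <= k%:R :> R by exact: ler0n.
have K0 : 0 < K by rewrite ltr_wpDl// mulr_ge0 ?addr_ge0 ?mulr_ge0 ?nn// ltW.
exists K => // xi phi Cphi; have bphi := Chat_bmeasv r0 Cphi.
apply: le_trans (upper _ bphi) _; set sn := state_norm r xi phi.
have sn0 : 0 <= sn by exact: le_trans (norm_le_state_norm r xi phi).
apply: (@le_trans _ _ (C * ((n%:R + nu%:R * r) * sn ^+ 2))); last first.
  by rewrite mulrA ler_wpM2r ?sqr_ge0// /K; lra.
rewrite ler_pM2l// mulrDl; apply: lerD.
  apply: le_trans (sqn_le_norm _) _; rewrite ler_wpM2l// lerXn2r ?nnegrE//.
  exact: norm_le_state_norm.
have bs : bmeas (fun tau => sqn (phi tau)).
  by under eq_fun do rewrite sqnE; exact: bmeas_blf.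
have -> : nu%:R * r * sn ^+ 2 = nu%:R * sn ^+ 2 * (0 - - r) by ring.
rewrite -itg_cst ?oppr_le0 ?(ltW r0)//; apply: itg_le => //; first exact: bmeas_cst.
move=> s _; apply: le_trans (sqn_le_norm _) _; rewrite ler_wpM2l// lerXn2r ?nnegrE//.
exact: history_le_state_norm.
Qed.

Lemma x_decay : exists2 K : R, 0 < K & forall t0 xi phi x y, Chat r phi ->
  is_trajectory sys r t0 xi phi (fun=> 0) x y -> forall t, t0 <= t ->
  sqn (x t) * (1 + c * (t - t0)) <= K * state_norm r xi phi ^+ 2.
Proof.
have [K K0 HK] := lyap_initial; exists (K / e1); first exact: divr_gt0.
move=> t0 xi phi x y Cphi traj t t0t.
rewrite mulrAC ler_pdivlMr// mulrC.
apply: le_trans (HK xi phi Cphi); apply: le_trans (lyap_decay Cphi traj t0t).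
rewrite mulrA ler_wpM2r//; first by rewrite addr_ge0// mulr_ge0 ?subr_ge0// ltW.
by apply: lower; exact: (bmeasv_segment r0 Cphi traj).
Qed.

Lemma S_coercive u : e2 * sqn u <= qf S u.
Proof. by have := contraction u; have := pS (A5 sys *m u); lra. Qed.

(** In the norm of S the map A5 is a strict contraction, and Young's inequality absorbs
the input A4 v at the cost of a slightly larger contraction factor. *)
Lemma output_contraction : exists th K : R, [/\ 0 <= th < 1, 0 <= K & forall u v,
  qf S (A5 sys *m u + A4 sys *m v) <= th * qf S u + K * sqn v].
Proof.
pose s := mxabs S + e2; have s0 : 0 < s by rewrite ltr_wpDl// mxabs_ge0.
pose k := e2 / s.
have k0 : 0 < k by exact: divr_gt0.
have k1 : k <= 1 by rewrite ler_pdivrMr// mul1r /s lerDr mxabs_ge0.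
have contr u : qf S (A5 sys *m u) <= (1 - k) * qf S u.
  have H1 := contraction u; have H2 := qf_le_sqn S u.
  have H3 : k * qf S u <= e2 * sqn u.
    rewrite /k mulrAC ler_pdivrMr// -mulrA ler_pM2l// mulrC.
    by apply: le_trans H2 _; rewrite ler_wpM2r ?sqn_ge0// /s lerDl ltW.
  by lra.
pose K := (1 + k^-1) * mxabs ((A4 sys)^T *m S *m A4 sys).
(* Young's parameter k gives the factor (1 + k)(1 - k) = 1 - k^2 < 1. *)
exists ((1 + k) * (1 - k)), K; split.
- by apply/andP; split; nra.
- by rewrite mulr_ge0 ?mxabs_ge0// addr_ge0// invr_ge0 ltW.
move=> u v; apply: le_trans (qf_young _ _ pS k0) _; apply: lerD.
  by rewrite -mulrA ler_wpM2l//; lra.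
rewrite /K -mulrA ler_wpM2l//; first by rewrite addr_ge0// invr_ge0 ltW.
by rewrite blf_mul; exact: qf_le_sqn.
Qed.

Lemma state_norm_le t0 xi phi w x y t M : Chat r phi ->
  is_trajectory sys r t0 xi phi w x y -> t0 <= t -> 0 <= M ->
  sqn (x t) <= M ^+ 2 -> (forall s, t - r <= s < t -> sqn (ycut r t0 y s) <= M ^+ 2) ->
  state_norm r (x t) (segment r y t) <= M.
Proof.
move=> Cphi traj t0t M0 xM yM; rewrite /state_norm ge_max norm_le_sqn//=.
apply: supnorm_le => // s /andP[s1 s2].
rewrite /segment /patch mem_set/= ?in_itv/= ?s1//.
rewrite -(@ycutE _ _ r t0 y); last by lra.
by apply: norm_le_sqn => //; apply: yM; apply/andP; split; lra.
Qed.

Lemma y_bounded : exists2 K : R, 0 < K & forall t0 xi phi x y, Chat r phi ->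
  is_trajectory sys r t0 xi phi (fun=> 0) x y -> forall s,
  qf S (ycut r t0 y s) <= K * state_norm r xi phi ^+ 2.
Proof.
have [K1 K10 HK1] := x_decay.
have [th [K2 [/andP[th0 th1] K20 HK2]]] := output_contraction.
pose K := mxabs S * nu%:R + K2 * K1 / (1 - th) + 1.
have th1' : 0 < 1 - th by lra.
have a0 : 0 <= mxabs S * nu%:R by rewrite mulr_ge0 ?mxabs_ge0.
have b0 : 0 <= K2 * K1 / (1 - th) by rewrite divr_ge0 ?mulr_ge0// ltW.
have K0 : 0 < K by rewrite /K; lra.
exists K => // t0 xi phi x y Cphi traj; set sn := state_norm r xi phi.
have sn0 : 0 <= sn by exact: le_trans (norm_le_state_norm r xi phi).
have sn2 : 0 <= sn ^+ 2 by exact: sqr_ge0.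
apply: (step_ind r0 (t0 := t0)) => [s st|s ts IH].
  rewrite (ycut_history Cphi traj st); apply: le_trans (qf_le_sqn _ _) _.
  apply: (@le_trans _ _ (mxabs S * (nu%:R * sn ^+ 2))).
    rewrite ler_wpM2l ?mxabs_ge0//; apply: le_trans (sqn_le_norm _) _.
    by rewrite ler_wpM2l// lerXn2r ?nnegrE// history_le_state_norm.
  by rewrite mulrA ler_wpM2r// /K; lra.
rewrite (ycut_step r0 traj ts) addrC; apply: le_trans (HK2 _ _) _.
have x1 : sqn (x s) <= K1 * sn ^+ 2.
  apply: le_trans (HK1 _ _ _ _ _ Cphi traj s ts); rewrite ler_peMr ?sqn_ge0// lerDl.
  by rewrite mulr_ge0 ?subr_ge0// ltW.
have h1 : th * qf S (ycut r t0 y (s - r)) <= th * (K * sn ^+ 2) by rewrite ler_wpM2l.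
have h2 : K2 * sqn (x s) <= K2 * (K1 * sn ^+ 2) by rewrite ler_wpM2l.
apply: le_trans (lerD h1 h2) _.
rewrite (mulrA th) (mulrA K2) -mulrDl ler_wpM2r//.
have : K2 * K1 <= (1 - th) * K.
  rewrite -ler_pdivrMl// mulrC /K; lra.
lra.
Qed.

Lemma lyap_uniformly_stable : uniformly_stable sys r.
Proof.
have [K1 K10 HK1] := x_decay; have [K2 K20 HK2] := y_bounded.
pose K := 1 + K1 + K2 / e2.
have K3 : 0 < K2 / e2 by exact: divr_gt0.
have K0 : 1 <= K by rewrite /K; lra.
have KK : K <= K ^+ 2 by rewrite expr2 ler_peMr//; lra.
move=> e e0; exists (e / (K + 1)); first by rewrite divr_gt0//; lra.
move=> t0 xi phi x y Cphi traj; set sn := state_norm r xi phi => sne t t0t.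
have sn0 : 0 <= sn by exact: le_trans (norm_le_state_norm r xi phi).
have sn2 : 0 <= sn ^+ 2 by exact: sqr_ge0.
apply: (@le_lt_trans _ _ (K * sn)); last first.
  by move: sne; rewrite ltr_pdivlMr; [lra|lra].
apply: (state_norm_le Cphi traj) => //; first by rewrite mulr_ge0//; lra.
  apply: (@le_trans _ _ (K1 * sn ^+ 2)).
    apply: le_trans (HK1 _ _ _ _ _ Cphi traj t t0t); rewrite ler_peMr ?sqn_ge0// lerDl.
    by rewrite mulr_ge0 ?subr_ge0// ltW.
  by rewrite exprMn ler_wpM2r//; apply: le_trans KK; rewrite /K; lra.
move=> s _; rewrite exprMn; apply: (@le_trans _ _ (K2 / e2 * sn ^+ 2)).
  rewrite mulrAC ler_pdivlMr// mulrC; apply: le_trans (S_coercive _) _.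
  exact: HK2 Cphi traj s.
by rewrite ler_wpM2r//; apply: le_trans KK; rewrite /K; lra.
Qed.

(** After the time T1 the state x is small whatever the initial data of norm below b; k
more delays then let the contraction of the difference equation erase the history. *)
Lemma lyap_uniformly_attractive : globally_uniformly_attractive sys r.
Proof.
have [K1 K10 HK1] := x_decay; have [B B0 HB] := y_bounded.
have [th [K2 [/andP[th0 th1] K20 HK2]]] := output_contraction.
have th1' : 0 < 1 - th by lra.
move=> b e b0 e0.
pose k1 := (1 + K2 / (1 - th)) / e2.
have k10 : 0 < k1 by rewrite divr_gt0// ltr_wpDr// divr_ge0// ltW.
(* e' is small enough for both sqn (x t) <= e' and the resulting bound k1 * e' on
   sqn (y t) to be at most (e / 2)^2. *)
pose e' := (e / 2) ^+ 2 / (1 + k1).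
have e'0 : 0 < e' by rewrite divr_gt0 ?exprn_gt0 ?divr_gt0// ltr_wpDr// ltW.
pose T1 := K1 * b ^+ 2 / (e' * c).
have T10 : 0 <= T1 by apply: divr_ge0; rewrite mulr_ge0 ?sqr_ge0 ?(ltW K10) ?(ltW e'0) ?(ltW c_gt0).
have Bb : 0 < B * b ^+ 2 by rewrite mulr_gt0// exprn_gt0.
have [k Hk] := expr_lt_eventually (introT andP (conj th0 th1)) (divr_gt0 e'0 Bb).
have kr i : 0 <= i%:R * r by rewrite mulr_ge0// ltW.
exists (T1 + k.+1%:R * r); first by rewrite addr_ge0.
move=> t0 xi phi x y Cphi traj; set sn := state_norm r xi phi => snb t t0t.
have sn0 : 0 <= sn by exact: le_trans (norm_le_state_norm r xi phi).
have sn2 : sn ^+ 2 <= b ^+ 2 by rewrite lerXn2r ?nnegrE// ltW.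
have xs s : t0 + T1 <= s -> sqn (x s) <= e'.
  move=> ts; have t0s : t0 <= s by lra.
  have := HK1 _ _ _ _ _ Cphi traj s t0s; rewrite -/sn => H.
  have D : 0 < 1 + c * (s - t0) by rewrite ltr_pwDl// mulr_ge0 ?subr_ge0// ltW.
  rewrite -(ler_pM2r D); apply: le_trans H _.
  apply: (@le_trans _ _ (K1 * b ^+ 2)); first by rewrite ler_pM2l.
  have : e' * c * T1 <= e' * c * (s - t0).
    by apply: ler_wpM2l; [apply: mulr_ge0; exact: ltW|rewrite lerBrDl].
  have -> : e' * c * T1 = K1 * b ^+ 2 by rewrite /T1; field; rewrite !gt_eqF.
  lra.
have ys i s : t0 + T1 + i%:R * r <= s ->
    qf S (ycut r t0 y s) <= th ^+ i * (B * b ^+ 2) + K2 * e' / (1 - th).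
  elim: i s => [|i IH] s.
    move=> _; rewrite expr0 mul1r; apply: le_trans (HB _ _ _ _ _ Cphi traj s) _.
    rewrite -[leLHS]addr0; apply: lerD; first by rewrite ler_pM2l.
    by apply: divr_ge0; [apply: mulr_ge0 => //|]; exact: ltW.
  rewrite -natr1 mulrDl mul1r => ts.
  have := kr i => kri; have rp := r0.
  rewrite (ycut_step r0 traj); last by lra.
  rewrite addrC; apply: le_trans (HK2 _ _) _.
  have h1 : th * qf S (ycut r t0 y (s - r)) <= th * (th ^+ i * (B * b ^+ 2) + K2 * e' / (1 - th)).
    by rewrite ler_wpM2l//; apply: IH; lra.
  have h2 : K2 * sqn (x s) <= K2 * e' by rewrite ler_wpM2l//; apply: xs; lra.
  have E : K2 * e' = (1 - th) * (K2 * e' / (1 - th)) by rewrite [RHS]mulrC divfK ?gt_eqF.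
  have alg W Z : th * (W + Z) + (1 - th) * Z <= th * W + Z by lra.
  apply: le_trans (lerD h1 h2) _; rewrite [X in _ + X <= _]E (exprS th) -(mulrA th).
  exact: alg.
have kk := kr k.+1.
apply: (@le_lt_trans _ _ (e / 2)); last by lra.
apply: (state_norm_le Cphi traj) => //; [by lra|by lra| |].
  apply: le_trans (xs t _) _; first by lra.
  rewrite /e' ler_pdivrMr ?ler_peMr ?sqr_ge0//; last by lra.
  by lra.
move=> s /andP[ts st].
have st' : t0 + T1 + k%:R * r <= s by move: t0t; rewrite -natr1 mulrDl; lra.
have := ys k s st' => H.
have H2 : th ^+ k * (B * b ^+ 2) <= e' by rewrite -ler_pdivlMr// ltW.
have H3 := S_coercive (ycut r t0 y s).
rewrite -(ler_pM2l e2_gt0); apply: le_trans H3 _; apply: le_trans H _.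
apply: (@le_trans _ _ (e' * (1 + K2 / (1 - th)))).
  rewrite mulrDr mulr1; apply: lerD => //.
  by rewrite mulrA [e' * _]mulrC.
have -> : 1 + K2 / (1 - th) = e2 * k1 by rewrite /k1; field; rewrite !gt_eqF.
rewrite mulrCA ler_pM2l// /e' -mulrA ler_piMr ?sqr_ge0//.
by rewrite -ler_pdivlMl ?invr_gt0 ?invrK; lra.
Qed.

End Stability.

(** * Dissipativity and stability at every delay *)

Section FixedDelay.
Variables (R : realType) (n nu m q d : nat) (sys : delay_system R n nu m q d).
Variables (r : R) (Lac : 'M[R]_d.+1).
Variables (J1 Jt : 'M[R]_m) (J2 : 'M[R]_(m, q)) (J3 : 'M[R]_q).
Variables (P : 'M[R]_(n + d.+1 * nu)) (S U : 'M[R]_nu).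
Hypotheses (r0 : 0 < r) (hLac : is_legendre_derivative_mx Lac).
Hypotheses (sJ1 : J1^T = J1) (uJ1 : J1 \in unitmx) (nJ1 : negdefmx (invmx J1)).
Hypotheses (sP : P^T = P) (pS : psd S) (pU : psd U).
Hypothesis pP : posdefmx (P + dsum (0 : 'M[R]_n) (Dmx R d *t S)).
Hypothesis pB : posdefmx (- block_val sys r Lac J1 Jt J2 J3 P S U).

(** The perturbation of [U] by [s%:M] makes the functional decrease at a rate that
controls the whole history and not only its Legendre coefficients. The same
functional therefore yields dissipativity and, for w = 0, decay. *)
Lemma dissipation_along : exists s e : R, [/\ 0 < s, 0 < e &
  forall t0 xi phi w x y, Chat r phi -> is_trajectory sys r t0 xi phi w x y ->
  forall t, regular_time sys r t0 w x y t ->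
  lyap_rate sys r t0 w x y Lac P S (U + s%:M) t
    - supply_rate J1 Jt J2 J3 (output sys r w x y t) (w t)
  <= - (e * (sqn (x t) + itg (- r) 0 (fun tau => sqn (hist r t0 y t tau))))].
Proof.
have [e [s [e0 s0 H]]] := strict_dissipation r0 sP pU sJ1 uJ1 pB.
exists s, (Num.min e s); split => //; first by rewrite lt_min e0.
move=> t0 xi phi w x y Cphi traj t [t0t _ _]; have t0t' := ltW t0t.
have b := bmeasv_hist r0 Cphi traj t.
have := H (w t) (x t) (hist r t0 y t) (y (t - r)) b
  (esym (eta_Phi_left (q := q) d t0 w x y r0 t)).
rewrite (output_Sigma r0 Cphi traj t0t') /lyap_rate.
rewrite (y_Gamma (d := d) traj t0t') => {}H.
apply: le_trans H _; rewrite -opprD lerN2 mulrDr; apply: lerD.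
  apply: (@le_trans _ _ (e * sqn (x t))).
    by rewrite ler_wpM2r ?sqn_ge0// ge_min lexx.
  rewrite ler_pM2l// /chi_vec !sqn_col addrCA lerDl !addr_ge0 ?sqn_ge0//.
rewrite ler_wpM2r ?ge_min ?lexx ?orbT//.
by apply: itg_ge0 => *; exact: sqn_ge0.
Qed.

Lemma dissipative_stable_fixed_delay :
  (exists v, differentiable_functional r v /\
    forall t0 xi phi w x y, Chat r phi -> is_trajectory sys r t0 xi phi w x y ->
    let V := fun t : R => v (x t) (segment r y t) in
    loc_abs_continuous t0 V /\
    {ae @lebesgue_measure R, forall t, t0 <= t -> derivable V t 1 /\
       derive1 V t - supply_rate J1 Jt J2 J3 (output sys r w x y t) (w t) <= 0}) /\
  guas sys r.
Proof.
have [s [e [s0 e0 H]]] := dissipation_along.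
have pUs : psd (U + s%:M) by apply: psdD => //; apply: psd_scalar; exact: ltW.
split.
  exists (lyap r P S (U + s%:M)); split; first exact: lyap_differentiable.
  move=> t0 xi phi w x y Cphi traj V.
  have [acV dV] := acd_lyap r0 Cphi traj hLac P S (U + s%:M).
  split; first exact: acV.
  apply: (@filterS _ _ (lebesgue_ae_filter R)) (regular_time_ae r0 Cphi traj) => t Ht t0t.
  have [DV EV] := dV t (Ht t0t).
  split; first exact: DV.
  rewrite derive1E EV; apply: le_trans (H _ _ _ _ _ _ Cphi traj t (Ht t0t)) _.
  rewrite oppr_le0 mulr_ge0 ?(ltW e0)// addr_ge0 ?sqn_ge0//.
  by apply: itg_ge0 => *; exact: sqn_ge0.
have [e1 e10 lower] := lyap_lower r0 pS pUs pP.
have [C C0 upper] := lyap_upper P S r0 pUs.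
have [e2 e20 contr] := difference_contraction r0 pS pU pB.
have decay t0 xi phi x y : Chat r phi ->
  is_trajectory sys r t0 xi phi (fun=> 0) x y -> forall t,
  regular_time sys r t0 (fun=> 0) x y t ->
  lyap_rate sys r t0 (fun=> 0) x y Lac P S (U + s%:M) t <=
  - (e / C * lyap r P S (U + s%:M) (x t) (segment r y t)).
  move=> Cphi traj t Ht; have t0t : t0 <= t by case: Ht => /ltW.
  have := H _ _ _ _ _ _ Cphi traj t Ht; rewrite supply_rateE blf0l blf0r mulr0 !addr0.
  have J0 : qf (invmx J1) (Jt *m output sys r (fun=> 0) x y t) <= 0.
    by have := posdef_psd nJ1 (Jt *m output sys r (fun=> 0) x y t); rewrite blfN oppr_ge0.
  have := upper (x t) _ (bmeasv_hist r0 Cphi traj t).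
  rewrite (lyap_segment r0 Cphi traj P S (U + s%:M) t0t) -ler_pdivrMl//.
  rewrite -(ler_pM2l e0) mulrA; lra.
have ec : 0 < e / C by exact: divr_gt0.
split.
  exact: (lyap_uniformly_stable hLac r0 e10 C0 ec e20 lower upper decay pS contr).
exact: (lyap_uniformly_attractive hLac r0 e10 C0 ec e20 lower upper decay pS contr).
Qed.

End FixedDelay.

Section Evaluation.
Variable R : realType.
Implicit Types (x c : R).

Lemma mxevalD m p (F G : 'M[{poly R}]_(m, p)) x : mxeval (F + G) x = mxeval F x + mxeval G x.
Proof. exact: map_mxD. Qed.

Lemma mxevalZ m p (g : {poly R}) (F : 'M[{poly R}]_(m, p)) x :
  mxeval (g *: F) x = g.[x] *: mxeval F x.
Proof. exact: map_mxZ. Qed.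

Lemma mxeval_sympoly m (F : 'M[{poly R}]_m) x : sympoly F -> (mxeval F x)^T = mxeval F x.
Proof. by move=> sF; rewrite /mxeval map_trmx sF. Qed.

Lemma mxeval_dsum_tens n d nu (D : 'M[R]_d) (S : 'M[{poly R}]_nu) x :
  mxeval (dsum (0 : 'M[{poly R}]_n) (map_mx polyC D *t S)) x =
  dsum (0 : 'M[R]_n) (D *t mxeval S x).
Proof.
rewrite /mxeval /dsum map_block_mx !map_mx0; congr block_mx.
by apply/matrixP => i j; rewrite !mxE /horner_eval hornerM hornerC.
Qed.

Lemma sos_psd_eval delta m (F : 'M[{poly R}]_m) x : sos_psd delta F -> psd (mxeval F x).
Proof.
move=> [_ _ [k [Phi ->]]] u.
by rewrite -[_^T]mulmx1 -blf_mul -sqnE sqn_ge0.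
Qed.

End Evaluation.

Theorem theorem6p1 (R : realType) (n nu m q d : nat)
  (sys : delay_system R n nu m q d)
  (hA3 : poly_in_r (A3 sys)) (hC3 : poly_in_r (C3 sys))
  (hA5 : spectral_radius (A5 sys) < 1)
  (r1 r2 : R) (hr1 : 0 < r1) (hr2 : r1 < r2)
  (Lac : 'M[R]_d.+1) (hLac : is_legendre_derivative_mx Lac)
  (J1 Jt : 'M[R]_m) (J2 : 'M[R]_(m, q)) (J3 : 'M[R]_q)
  (hJ1 : J1^T = J1) (uJ1 : J1 \in unitmx) (nJ1 : negdefmx (invmx J1))
  (hJ3 : J3^T = J3)
  (lambda1 lambda2 lambda3 : nat)
  (g := ('X - r1%:P) * ('X - r2%:P) : {poly R}) :
  (exists (P Ph : 'M[{poly R}]_(n + d.+1 * nu)) (S U Sh Uh : 'M[{poly R}]_nu)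
     (Psi : 'M[{poly R}]_(m + (q + (n + (nu + d.+1 * nu)))))
     (delta1 delta2 delta3 delta4 delta5 delta6 delta7 delta8 : nat),
     [/\ [/\ sympoly P /\ mxdeg P = lambda1,
             sympoly S /\ mxdeg S = lambda2
           & sympoly U /\ mxdeg U = lambda3],
         [/\ sympoly Ph, sympoly Sh, sympoly Uh & sympoly Psi]
       & delta7 <> 0%N] /\
     [/\ sos_pd delta1
           (P + dsum (0 : 'M[{poly R}]_n) (map_mx polyC (Dmx R d) *t S)
              + g *: Ph)
         /\ sos_psd delta2 Ph,
         sos_psd delta3 (S + g *: Sh) /\ sos_psd delta4 Sh,
         sos_psd delta5 (U + g *: Uh) /\ sos_psd delta6 Uh
       & (* the polynomial [F] is determined by its values at [r > 0] *)
         (exists2 F : 'M[{poly R}]_(m + (q + (n + (nu + d.+1 * nu)))),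
           (forall r, 0 < r ->
              mxeval F r = - dissipation_block sys Lac J1 Jt J2 J3 P S U r
                           + g.[r] *: mxeval Psi r)
           & sos_pd delta7 F)
         /\ sos_psd delta8 Psi]) ->
  dissipative sys r1 r2 (supply_rate J1 Jt J2 J3) /\
  (forall r, r1 <= r <= r2 -> guas sys r).
Proof.
move=> [P [Ph [S [U [Sh [Uh [Psi [delta1 [delta2 [delta3 [delta4 [delta5 [delta6 [delta7 [delta8
  [[[[sP _] [sS _] [sU _]] [sPh _ _ sPsi] _] [[pP pPh] [pS pSh] [pU pUh] [[F FE pF] pPsi]]]
  ]]]]]]]]]]]]]]].
have fixed r : r1 <= r <= r2 ->
  (exists v, differentiable_functional r v /\
    forall t0 xi phi w x y, Chat r phi -> is_trajectory sys r t0 xi phi w x y ->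
    let V := fun t : R => v (x t) (segment r y t) in
    loc_abs_continuous t0 V /\
    {ae @lebesgue_measure R, forall t, t0 <= t -> derivable V t 1 /\
       derive1 V t - supply_rate J1 Jt J2 J3 (output sys r w x y t) (w t) <= 0}) /\
  guas sys r.
  move=> /andP[r1r rr2]; have r0 : 0 < r by exact: lt_le_trans hr1 r1r.
  have gr : g.[r] <= 0.
    by rewrite /g hornerM !hornerXsubC mulr_ge0_le0 ?subr_ge0 ?subr_le0.
  apply: (@dissipative_stable_fixed_delay _ _ _ _ _ _ _ _ Lac J1 Jt J2 J3
    (mxeval P r) (mxeval S r) (mxeval U r)) => //.
  - exact: mxeval_sympoly.
  - apply: (psd_multiplier gr (B := mxeval Sh r)); last exact: sos_psd_eval pSh.
    by rewrite -mxevalZ -mxevalD; exact: sos_psd_eval pS.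
  - apply: (psd_multiplier gr (B := mxeval Uh r)); last exact: sos_psd_eval pUh.
    by rewrite -mxevalZ -mxevalD; exact: sos_psd_eval pU.
  - apply: (posdef_multiplier gr (B := mxeval Ph r)); last exact: sos_psd_eval pPh.
      exact: mxeval_sympoly.
    by rewrite -mxevalZ -mxeval_dsum_tens -!mxevalD; exact: pP.2.
  - apply: (posdef_multiplier gr (B := mxeval Psi r)); last exact: sos_psd_eval pPsi.
      exact: mxeval_sympoly.
    by have := pF.2 r; rewrite FE.
split; last by move=> r /fixed[].
have ex r : exists v, r1 <= r <= r2 -> differentiable_functional r v /\
    forall t0 xi phi w x y, Chat r phi -> is_trajectory sys r t0 xi phi w x y ->
    let V := fun t : R => v (x t) (segment r y t) in
    loc_abs_continuous t0 V /\
    {ae @lebesgue_measure R, forall t, t0 <= t -> derivable V t 1 /\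
       derive1 V t - supply_rate J1 Jt J2 J3 (output sys r w x y t) (w t) <= 0}.
  have [rr|nrr] := boolP (r1 <= r <= r2); last by exists (fun _ _ => 0).
  by have [[v Hv] _] := fixed r rr; exists v.
have [v Hv] := choice ex.
exists v; split => [r /Hv[]//|r t0 xi phi w x y /Hv[_ H] Cphi _ traj].
exact: H Cphi traj.
Qed.
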